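(* Let $X$ be a proper geodesic space, $x_0\in X$ a basepoint, and $(g_n)$ a sequence of isometries of $X$. Assume that $g_n(x_0)\to p_1$ and $g_n^{-1}(x_0)\to p_2$ for points $p_1,p_2\in\partial_M X_{x_0}$. Let $U$ be any open neighborhood of $p_1$ in $\partial_M X_{x_0}$ and $K\subset\partial_M X_{x_0}$ any compact set with $p_2\notin K$. Then, after passing to a subsequence of $(g_n)$, there exists an integer $k$ such that $g_n(K)\subset U$ for all $n>k$.
   Context: A Morse gauge is a function $N:[1,\infty)\times[0,\infty)\to[0,\infty)$; a (quasi-)geodesic $\gamma$ is $N$-Morse if every $(\lambda,\epsilon)$-quasi-geodesic with endpoints on $\gamma$ lies in the $N(\lambda,\epsilon)$-neighborhood of $\gamma$. The Morse boundary $\partial_M X_{x_0}$ is the set of equivalence classes (finite Hausdorff distance) of Morse geodesic rays based at $x_0$. For a Morse gauge $N$, $\partial_M^N X_{x_0}$ is the subset of classes containing an $N$-Morse ray based at $x_0$, with the quotient of the compact-open topology on $N$-Morse rays based at $x_0$; $\partial_M X_{x_0}=\varinjlim_N\partial_M^N X_{x_0}$ (gauges ordered pointwise) with the direct limit topology. Isometries act on $\partial_M X_{x_0}$ by sending $[\alpha]$ to the class of $g\circ\alpha$. For points $y_n\in X$ and $p\in\partial_M X$, $y_n\to p$ means: there exist a Morse gauge $N$ and geodesics $[x_0,y_n]$ that are all $N$-Morse, such that every subsequence of $([x_0,y_n])$ has a further subsequence converging uniformly on compact sets to a geodesic ray $\gamma$ with $\gamma(0)=x_0$ and $[\gamma]=p$.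 *)

(* Defs.v *)
From Stdlib Require Import Reals Lra List.
Open Scope R_scope.

Record MetricSpace := {
  mcarrier :> Type;
  mdist : mcarrier -> mcarrier -> R;
  mdist_self : forall x, mdist x x = 0;
  mdist_eq0 : forall x y, mdist x y = 0 -> x = y;
  mdist_sym : forall x y, mdist x y = mdist y x;
  mdist_tri : forall x y z, mdist x z <= mdist x y + mdist y z }.
Arguments mdist {m} x y.

Definition metric_open {T : Type} (d : T -> T -> R) (O : T -> Prop) : Prop :=
  forall x, O x -> exists r, 0 < r /\ forall y, d x y < r -> O y.

Definition compact_in {T : Type} (opn : (T -> Prop) -> Prop) (A : T -> Prop) : Prop :=
  forall C : (T -> Prop) -> Prop,
    (forall O, C O -> opn O) ->
    (forall x, A x -> exists O, C O /\ O x) ->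
    exists l : list (T -> Prop),
      (forall O, In O l -> C O) /\ (forall x, A x -> exists O, In O l /\ O x).

Definition Rdist (s t : R) : R := Rabs (s - t).

Definition proper_space (X : MetricSpace) : Prop :=
  forall (x : X) (r : R), compact_in (metric_open (@mdist X)) (fun y => mdist x y <= r).

Definition geodesic_segment (X : MetricSpace) (c : R -> X) (x y : X) : Prop :=
  c 0 = x /\ c (mdist x y) = y /\
  forall s t, 0 <= s <= mdist x y -> 0 <= t <= mdist x y ->
    mdist (c s) (c t) = Rabs (s - t).

Definition geodesic_space (X : MetricSpace) : Prop :=
  forall x y : X, exists c, geodesic_segment X c x y.

Definition geodesic_ray (X : MetricSpace) (c : R -> X) : Prop :=
  forall s t, 0 <= s -> 0 <= t -> mdist (c s) (c t) = Rabs (s - t).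

Definition quasi_geodesic (X : MetricSpace) (lam eps a b : R) (q : R -> X) : Prop :=
  a <= b /\
  forall s t, a <= s <= b -> a <= t <= b ->
    / lam * Rabs (s - t) - eps <= mdist (q s) (q t) <= lam * Rabs (s - t) + eps.

(* Morse gauge N : [1,oo) x [0,oo) -> [0,oo) (values off the domain are irrelevant). *)
Definition Morse_gauge (N : R -> R -> R) : Prop :=
  forall lam eps, 1 <= lam -> 0 <= eps -> 0 <= N lam eps.

(* A path c with domain I is N-Morse: every (lam,eps)-quasi-geodesic with endpoints
   on c lies in the closed N(lam,eps)-neighbourhood of c(I). *)
Definition N_Morse (X : MetricSpace) (N : R -> R -> R) (I : R -> Prop) (c : R -> X) : Prop :=
  forall lam eps a b (q : R -> X), 1 <= lam -> 0 <= eps ->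
    quasi_geodesic X lam eps a b q ->
    (exists s, I s /\ q a = c s) -> (exists s, I s /\ q b = c s) ->
    forall t, a <= t <= b ->
      forall delta, 0 < delta -> exists s, I s /\ mdist (q t) (c s) < N lam eps + delta.

Definition nonneg (t : R) : Prop := 0 <= t.

Definition N_Morse_ray (X : MetricSpace) (x0 : X) (N : R -> R -> R) (c : R -> X) : Prop :=
  geodesic_ray X c /\ c 0 = x0 /\ N_Morse X N nonneg c.

Definition Morse_ray (X : MetricSpace) (x0 : X) (c : R -> X) : Prop :=
  exists N, Morse_gauge N /\ N_Morse_ray X x0 N c.

Definition hfin (X : MetricSpace) (a b : R -> X) : Prop :=
  exists C, (forall s, 0 <= s -> exists t, 0 <= t /\ mdist (a s) (b t) <= C) /\
            (forall t, 0 <= t -> exists s, 0 <= s /\ mdist (a s) (b t) <= C).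

Definition mclass (X : MetricSpace) (x0 : X) (a : R -> X) : (R -> X) -> Prop :=
  fun b => Morse_ray X x0 b /\ hfin X a b.

Definition boundary_pt (X : MetricSpace) (x0 : X) (P : (R -> X) -> Prop) : Prop :=
  exists a, Morse_ray X x0 a /\ P = mclass X x0 a.

Definition N_stratum (X : MetricSpace) (x0 : X) (N : R -> R -> R) (P : (R -> X) -> Prop) : Prop :=
  boundary_pt X x0 P /\ exists a, N_Morse_ray X x0 N a /\ P a.

Definition co_subbasic (X : MetricSpace) (S : (R -> X) -> Prop) : Prop :=
  exists (C : R -> Prop) (V : X -> Prop),
    (forall t, C t -> 0 <= t) /\ compact_in (metric_open Rdist) C /\
    metric_open (@mdist X) V /\ S = (fun f => forall t, C t -> V (f t)).

Definition co_open (X : MetricSpace) (O : (R -> X) -> Prop) : Prop :=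
  forall f, O f -> exists l : list ((R -> X) -> Prop),
    (forall S, In S l -> co_subbasic X S) /\ (forall S, In S l -> S f) /\
    (forall h, (forall S, In S l -> S h) -> O h).

(* Quotient topology on d^N_M X_{x0} (from the subspace of N-Morse rays at x0). *)
Definition stratum_open (X : MetricSpace) (x0 : X) (N : R -> R -> R)
    (W : ((R -> X) -> Prop) -> Prop) : Prop :=
  (forall P, W P -> N_stratum X x0 N P) /\
  exists O, co_open X O /\
    forall a, N_Morse_ray X x0 N a -> (W (mclass X x0 a) <-> O a).

Definition boundary_open (X : MetricSpace) (x0 : X) (W : ((R -> X) -> Prop) -> Prop) : Prop :=
  (forall P, W P -> boundary_pt X x0 P) /\
  forall N, Morse_gauge N ->
    stratum_open X x0 N (fun P => W P /\ N_stratum X x0 N P).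

Definition isometry (X : MetricSpace) (g : X -> X) : Prop :=
  forall x y, mdist (g x) (g y) = mdist x y.

Definition act (X : MetricSpace) (x0 : X) (g : X -> X) (P : (R -> X) -> Prop) : (R -> X) -> Prop :=
  fun b => Morse_ray X x0 b /\ exists a, P a /\ hfin X (fun t => g (a t)) b.

Definition strictly_incr (phi : nat -> nat) : Prop :=
  forall n m, (n < m)%nat -> (phi n < phi m)%nat.

(* y_n -> P in the sense of the paper.  Segments are extended constantly
   beyond their endpoint when compared with the limiting ray. *)
Definition converges_to_boundary (X : MetricSpace) (x0 : X) (y : nat -> X)
    (P : (R -> X) -> Prop) : Prop :=
  exists N, Morse_gauge N /\
  exists c : nat -> R -> X,
    (forall n, geodesic_segment X (c n) x0 (y n) /\
               N_Morse X N (fun t => 0 <= t <= mdist x0 (y n)) (c n)) /\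
    forall phi, strictly_incr phi ->
      exists psi, strictly_incr psi /\
      exists gam, geodesic_ray X gam /\ gam 0 = x0 /\ P gam /\
        forall T eps, 0 <= T -> 0 < eps ->
          exists n0, forall n, (n0 <= n)%nat -> forall t, 0 <= t <= T ->
            mdist (c (phi (psi n)) (Rmin t (mdist x0 (y (phi (psi n)))))) (gam t) < eps.

(* Main.v *)
(** Concatenating a quasi-geodesic, stopped where it is almost closest to a point [p], with a geodesic to [p] gives a quasi-geodesic. This yields uniform bounds for asymptotic Morse rays, the Morse property of two Morse sides glued at a corner, and thinness of triangles with two Morse sides.

A sequence in a compact set [K] which in every stratum can only accumulate at a point outside [K] does not exist. Hence [K] lies in one stratum, and the rays of [K] diverge, by a uniform time [R], from the geodesics [x0, g_n^-1 x0] tending to [p2 \notin K]. So geodesics from [g_n^-1 x0] to points of these rays pass uniformly close to [x0]. Applying [g_n], the points of [g_n K] are represented by rays of one fixed Morse gauge that fellow-travel [x0, g_n x0]. If they avoided the neighbourhood [U] for infinitely many [n], an ultralimit of such rays would stay at bounded distance from a ray representing [p1], so some of them would lie in [U]. *)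
From Stdlib Require Import Reals Lra Lia List Arith Classical.
From mathcomp Require classical.boolp classical.filter.
Require Import Defs.
Open Scope R_scope.

(** * Quasi-geodesics and Morse paths *)

Lemma mdist_nonneg {X : MetricSpace} (x y : X) : 0 <= mdist x y.
Proof.
  pose proof (mdist_tri X x y x) as H.
  rewrite mdist_self, (mdist_sym X y x) in H. lra.
Qed.

Lemma Rabs_le_between (x y : R) : Rabs x <= y -> - y <= x <= y.
Proof. intros H. unfold Rabs in H. destruct Rcase_abs; lra. Qed.

Lemma mdist_close {X : MetricSpace} (x x' y y' : X) :
  Rabs (mdist x y - mdist x' y') <= mdist x x' + mdist y y'.
Proof.
  pose proof (mdist_tri X x x' y). pose proof (mdist_tri X x' y' y).
  pose proof (mdist_tri X x' x y'). pose proof (mdist_tri X x y y').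
  rewrite (mdist_sym X x' x) in *. rewrite (mdist_sym X y' y) in *.
  apply Rabs_le. lra.
Qed.

Lemma geodesic_ray_dist0 {X : MetricSpace} (c : R -> X) t :
  geodesic_ray X c -> 0 <= t -> mdist (c 0) (c t) = t.
Proof.
  intros H Ht. rewrite H by lra. rewrite Rabs_left1; lra.
Qed.

(** Quasi-geodesics need not be continuous, so a closest point may not exist. A point that is
    optimal up to 1 does exist, since otherwise [f] could be lowered by 1 again and again, starting
    from [f s0]. *)
Lemma near_min (D : R -> Prop) (f : R -> R) s0 :
  D s0 -> (forall s, 0 <= f s) -> exists s, D s /\ forall s', D s' -> f s <= f s' + 1.
Proof.
  intros Ds0 f0. apply NNPP. intros H.
  assert (step : forall n, exists s, D s /\ f s <= f s0 - INR n).
  { induction n as [|n [s [Ds fs]]].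
    - exists s0. simpl. split; [easy|lra].
    - apply NNPP. intros H1. apply H. exists s. split; [easy|].
      intros s' Ds'. apply Rnot_lt_le. intros lt. apply H1. exists s'.
      split; [easy|]. rewrite S_INR. lra. }
  destruct (INR_unbounded (f s0)) as [n Hn].
  destruct (step n) as [s [_ fs]]. specialize (f0 s). lra.
Qed.

Lemma qg_ordered {X : MetricSpace} lam eps a b (q : R -> X) :
  a <= b ->
  (forall s t, a <= s -> s <= t -> t <= b ->
    / lam * (t - s) - eps <= mdist (q s) (q t) <= lam * (t - s) + eps) ->
  quasi_geodesic X lam eps a b q.
Proof.
  intros ab H. split; [easy|]. intros s t Hs Ht.
  destruct (Rle_dec s t).
  - rewrite Rabs_left1 by lra. replace (- (s - t)) with (t - s) by ring.
    apply H; lra.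
  - rewrite Rabs_right by lra. rewrite mdist_sym. apply H; lra.
Qed.

Lemma qg_reverse {X : MetricSpace} lam eps a b (q : R -> X) :
  quasi_geodesic X lam eps a b q ->
  quasi_geodesic X lam eps (- b) (- a) (fun t => q (- t)).
Proof.
  intros [ab H]. split; [lra|]. intros s t Hs Ht.
  replace (Rabs (s - t)) with (Rabs (- s - - t)); [apply H; lra|].
  rewrite <- (Rabs_Ropp (s - t)). f_equal. ring.
Qed.

Lemma qg_of_geodesic {X : MetricSpace} a b (q : R -> X) :
  a <= b ->
  (forall s t, a <= s <= b -> a <= t <= b -> mdist (q s) (q t) = Rabs (s - t)) ->
  quasi_geodesic X 1 0 a b q.
Proof.
  intros ab H. split; [easy|]. intros s t Hs Ht. rewrite H, Rinv_1 by easy. lra.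
Qed.

Lemma qg_perturb {X : MetricSpace} lam eps D a b (q q' : R -> X) :
  (forall t, a <= t <= b -> mdist (q t) (q' t) <= D) ->
  quasi_geodesic X lam eps a b q -> quasi_geodesic X lam (eps + 2 * D) a b q'.
Proof.
  intros HD [ab H]. split; [easy|]. intros s t Hs Ht.
  pose proof (mdist_close (q s) (q' s) (q t) (q' t)) as C.
  apply Rabs_le_between in C. pose proof (HD s Hs). pose proof (HD t Ht).
  specialize (H s t Hs Ht). lra.
Qed.

Lemma inv_bounds lam : 1 <= lam -> 0 < / lam <= 1 /\ / (3 * lam) = / lam / 3.
Proof.
  intros H. split; [split|].
  - apply Rinv_0_lt_compat; lra.
  - rewrite <- Rinv_1. apply Rinv_le_contravar; lra.
  - field; lra.
Qed.

(** Since [q t] is almost closest to [p], a point at distance [r] from [q t] along [sig] has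
    distance at least [r - 1] from every [q u]. Twice this bound plus the triangle inequality
    through [q t], divided by three, gives the lower estimate; hence the factor 3. *)
Lemma qg_append_closest {X : MetricSpace} lam eps a b (q sig : R -> X) t p :
  1 <= lam -> 0 <= eps -> quasi_geodesic X lam eps a b q -> a <= t <= b ->
  geodesic_segment X sig (q t) p ->
  (forall s, a <= s <= b -> mdist (q t) p <= mdist (q s) p + 1) ->
  quasi_geodesic X (3 * lam) (eps + 1) a (t + mdist (q t) p)
    (fun s => if Rle_dec s t then q s else sig (s - t)).
Proof.
  intros Hlam Heps [ab Q] Ht [S0 [S1 S]] Hmin.
  pose proof (mdist_nonneg (q t) p).
  destruct (inv_bounds lam Hlam) as [Hi Hi3].
  set (i := / lam) in *. set (l := mdist (q t) p) in *.
  apply qg_ordered; [lra|]. intros u v au uv vb. rewrite Hi3.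
  fold i.
  destruct (Rle_dec u t), (Rle_dec v t); try lra.
  - assert (B : i * (v - u) - eps <= mdist (q u) (q v) <= lam * (v - u) + eps).
    { replace (v - u) with (Rabs (u - v)); [apply Q; lra|].
      rewrite Rabs_left1; lra. }
    assert (0 <= i * (v - u)) by (apply Rmult_le_pos; lra).
    assert (0 <= lam * (v - u)) by (apply Rmult_le_pos; lra). lra.
  - assert (B : i * (t - u) - eps <= mdist (q u) (q t) <= lam * (t - u) + eps).
    { replace (t - u) with (Rabs (u - t)); [apply Q; lra|].
      rewrite Rabs_left1; lra. }
    assert (W0 : mdist (q t) (sig (v - t)) = v - t).
    { rewrite <- S0, S by lra. rewrite Rabs_left1; lra. }
    assert (W1 : mdist (sig (v - t)) p = l - (v - t)).
    { rewrite <- S1, S by lra. rewrite Rabs_left1; lra. }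
    assert (M : l <= mdist (q u) p + 1) by (apply Hmin; lra).
    pose proof (mdist_tri X (q u) (sig (v - t)) p).
    pose proof (mdist_tri X (q u) (sig (v - t)) (q t)) as T1.
    rewrite (mdist_sym X (sig (v - t)) (q t)) in T1.
    pose proof (mdist_tri X (q u) (q t) (sig (v - t))).
    assert (i * (v - t) <= 1 * (v - t)) by (apply Rmult_le_compat_r; lra).
    assert (1 * (v - t) <= lam * (v - t)) by (apply Rmult_le_compat_r; lra).
    assert (0 <= lam * (t - u)) by (apply Rmult_le_pos; lra).
    lra.
  - rewrite S by lra. rewrite Rabs_left1 by lra.
    assert (i * (v - u) <= 1 * (v - u)) by (apply Rmult_le_compat_r; lra).
    assert (1 * (v - u) <= lam * (v - u)) by (apply Rmult_le_compat_r; lra).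
    lra.
Qed.

(* Quasi-geodesics need not be continuous, so their endpoints can be moved onto [c] at the cost of enlarging the additive constant only. *)
Lemma Morse_perturb_ends {X : MetricSpace} N I (c : R -> X) lam eps D a b q :
  N_Morse X N I c -> 1 <= lam -> 0 <= eps -> 0 <= D ->
  quasi_geodesic X lam eps a b q ->
  (exists s, I s /\ mdist (q a) (c s) <= D) ->
  (exists s, I s /\ mdist (q b) (c s) <= D) ->
  0 <= N lam (eps + 2 * D) ->
  forall t, a <= t <= b ->
    exists s, I s /\ mdist (q t) (c s) <= N lam (eps + 2 * D) + 1 + D.
Proof.
  intros M Hlam Heps HD Q [sa [Ia da]] [sb [Ib db]] N0 t Ht.
  destruct (Req_dec t a) as [->|ta].
  { exists sa. split; [easy|lra]. }
  destruct (Req_dec t b) as [->|tb].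
  { exists sb. split; [easy|lra]. }
  set (q' := fun t => if Req_dec_T t a then c sa else if Req_dec_T t b then c sb else q t).
  assert (Q' : quasi_geodesic X lam (eps + 2 * D) a b q').
  { apply (qg_perturb lam eps D a b q q'); [|easy]. intros u Hu. unfold q'.
    destruct (Req_dec_T u a) as [->|]; [easy|].
    destruct (Req_dec_T u b) as [->|]; [easy|].
    rewrite mdist_self. easy. }
  destruct (M lam (eps + 2 * D) a b q' Hlam ltac:(lra) Q') with (t := t) (delta := 1)
    as [s [Is ds]]; try lra.
  - exists sa. split; [easy|]. unfold q'. destruct (Req_dec_T a a); easy.
  - exists sb. split; [easy|]. unfold q'. destruct (Req_dec_T b a); [lra|].
    destruct (Req_dec_T b b); easy.
  - exists s. split; [easy|]. unfold q' in ds.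
    destruct (Req_dec_T t a); [easy|]. destruct (Req_dec_T t b); [easy|]. lra.
Qed.

(** The additive constant grows by [2 * D] because both ends of a quasi-geodesic are moved by at
    most [D]. In the value, one [D] accounts for the moved ends and one for the passage from [c] to
    [c']. *)
Definition close_gauge (N : R -> R -> R) (D : R) : R -> R -> R :=
  fun lam eps => N lam (eps + 2 * D) + 1 + 2 * D.

Lemma close_gauge_Morse N D : Morse_gauge N -> 0 <= D -> Morse_gauge (close_gauge N D).
Proof.
  intros HN HD lam eps Hl He. unfold close_gauge.
  specialize (HN lam (eps + 2 * D) Hl ltac:(lra)). lra.
Qed.

Lemma Morse_close {X : MetricSpace} N I I' (c c' : R -> X) D :
  Morse_gauge N -> 0 <= D -> N_Morse X N I c ->
  (forall s, I s -> exists s', I' s' /\ mdist (c s) (c' s') <= D) ->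
  (forall s', I' s' -> exists s, I s /\ mdist (c s) (c' s') <= D) ->
  N_Morse X (close_gauge N D) I' c'.
Proof.
  intros HN HD M H1 H2 lam eps a b q Hl He Q [sa [Ia Ea]] [sb [Ib Eb]] t Ht delta Hd.
  destruct (Morse_perturb_ends N I c lam eps D a b q M Hl He HD Q) with (t := t)
    as [s [Is ds]]; try easy.
  - destruct (H2 sa Ia) as [s [Is ds]]. exists s. split; [easy|].
    rewrite Ea, mdist_sym. easy.
  - destruct (H2 sb Ib) as [s [Is ds]]. exists s. split; [easy|].
    rewrite Eb, mdist_sym. easy.
  - apply HN; lra.
  - destruct (H1 s Is) as [s' [Is' ds']]. exists s'. split; [easy|].
    pose proof (mdist_tri X (q t) (c s) (c' s')). unfold close_gauge. lra.
Qed.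

Definition travel_const (N : R -> R -> R) (D : R) : R := 2 * (N 1 (2 * D) + 1 + D) + D.

(** By the Morse property [beta t] is near some [c s]. Both paths have unit speed and start near
    each other, so [s] is close to [t]; this second estimate doubles the constant. The bound is
    independent of [L]. *)
Lemma fellow_travel {X : MetricSpace} N (I : R -> Prop) (c beta : R -> X) D L :
  Morse_gauge N -> 0 <= D -> 0 <= L -> N_Morse X N I c ->
  (forall s, I s -> 0 <= s) -> I 0 ->
  (forall s t, I s -> I t -> mdist (c s) (c t) = Rabs (s - t)) ->
  (forall s t, 0 <= s <= L -> 0 <= t <= L -> mdist (beta s) (beta t) = Rabs (s - t)) ->
  mdist (beta 0) (c 0) <= D ->
  (exists s, I s /\ mdist (beta L) (c s) <= D) ->
  forall t, 0 <= t <= L -> I t -> mdist (beta t) (c t) <= travel_const N D.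
Proof.
  intros HN HD HL M I0 II0 G Gb B0 BL t Ht It. unfold travel_const.
  pose proof (HN 1 (2 * D) ltac:(lra) ltac:(lra)).
  destruct (Morse_perturb_ends N I c 1 0 D 0 L beta M ltac:(lra) ltac:(lra) HD)
    with (t := t) as [s [Is ds]]; try easy.
  - apply qg_of_geodesic; easy.
  - exists 0. easy.
  - rewrite Rplus_0_l. easy.
  - rewrite Rplus_0_l in ds. set (E := N 1 (2 * D)) in *.
    assert (T : mdist (c s) (c t) <= (E + 1 + D) + D).
    { rewrite G by easy.
      replace (s - t) with (mdist (c s) (c 0) - mdist (beta t) (beta 0)).
      - pose proof (mdist_close (c s) (beta t) (c 0) (beta 0)) as C.
        rewrite (mdist_sym X (c s) (beta t)), (mdist_sym X (c 0) (beta 0)) in C. lra.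
      - rewrite G, Gb by (easy || lra). specialize (I0 s Is).
        rewrite !Rabs_right by lra. lra. }
    pose proof (mdist_tri X (beta t) (c s) (c t)). lra.
Qed.

Lemma fellow_travel_ray {X : MetricSpace} N (c beta : R -> X) D L :
  Morse_gauge N -> 0 <= D -> 0 <= L -> geodesic_ray X c -> N_Morse X N nonneg c ->
  (forall s t, 0 <= s <= L -> 0 <= t <= L -> mdist (beta s) (beta t) = Rabs (s - t)) ->
  mdist (beta 0) (c 0) <= D ->
  (exists s, nonneg s /\ mdist (beta L) (c s) <= D) ->
  forall t, 0 <= t <= L -> mdist (beta t) (c t) <= travel_const N D.
Proof.
  intros HN HD HL G M Gb B0 BL t Ht.
  apply (fellow_travel N nonneg c beta D L); unfold nonneg in *; try easy; lra.
Qed.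

Lemma fellow_travel_segment {X : MetricSpace} N (c beta : R -> X) x y D L :
  Morse_gauge N -> 0 <= D -> 0 <= L -> geodesic_segment X c x y ->
  N_Morse X N (fun t => 0 <= t <= mdist x y) c ->
  (forall s t, 0 <= s <= L -> 0 <= t <= L -> mdist (beta s) (beta t) = Rabs (s - t)) ->
  mdist (beta 0) x <= D ->
  (exists s, 0 <= s <= mdist x y /\ mdist (beta L) (c s) <= D) ->
  forall t, 0 <= t <= L -> t <= mdist x y -> mdist (beta t) (c t) <= travel_const N D.
Proof.
  intros HN HD HL [G0 [_ G]] M Gb B0 BL t Ht Ht'.
  pose proof (mdist_nonneg x y). rewrite <- G0 in B0.
  apply (fellow_travel N (fun t => 0 <= t <= mdist x y) c beta D L); try easy; lra.
Qed.

(* Applies although [q b] is not on [c]: up to time [t], replace the rest of [q] by a geodesic to [p]. *)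
Lemma Morse_center {X : MetricSpace} N I (c : R -> X) lam eps a b q t p :
  geodesic_space X -> N_Morse X N I c -> 1 <= lam -> 0 <= eps ->
  quasi_geodesic X lam eps a b q -> a <= t <= b ->
  (forall s, a <= s <= b -> mdist (q t) p <= mdist (q s) p + 1) ->
  (exists s, I s /\ p = c s) -> (exists s, I s /\ q a = c s) ->
  forall u, a <= u <= t -> forall delta, 0 < delta ->
    exists s, I s /\ mdist (q u) (c s) < N (3 * lam) (eps + 1) + delta.
Proof.
  intros GX M Hl He Q Ht Hmin Ip Ia u Hu delta Hd.
  destruct (GX (q t) p) as [sig S].
  pose proof (qg_append_closest lam eps a b q sig t p Hl He Q Ht S Hmin) as Q'.
  pose proof (mdist_nonneg (q t) p) as l0.
  destruct (M (3 * lam) (eps + 1) a (t + mdist (q t) p) _ ltac:(lra) ltac:(lra) Q')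
    with (t := u) (delta := delta) as [s [Is ds]]; try lra.
  - destruct (Rle_dec a t); [easy|lra].
  - destruct Ip as [s [Is E]]. exists s. split; [easy|]. rewrite <- E.
    destruct S as [S0 [S1 _]].
    destruct (Rle_dec (t + mdist (q t) p) t) as [l|l].
    + assert (Z : mdist (q t) p = 0) by lra. rewrite Z, Rplus_0_r. apply mdist_eq0; easy.
    + replace (t + mdist (q t) p - t) with (mdist (q t) p) by ring. easy.
  - exists s. split; [easy|]. destruct (Rle_dec u t); [easy|lra].
Qed.

Lemma Morse_center_r {X : MetricSpace} N I (c : R -> X) lam eps a b q t p :
  geodesic_space X -> N_Morse X N I c -> 1 <= lam -> 0 <= eps ->
  quasi_geodesic X lam eps a b q -> a <= t <= b ->
  (forall s, a <= s <= b -> mdist (q t) p <= mdist (q s) p + 1) ->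
  (exists s, I s /\ p = c s) -> (exists s, I s /\ q b = c s) ->
  forall u, t <= u <= b -> forall delta, 0 < delta ->
    exists s, I s /\ mdist (q u) (c s) < N (3 * lam) (eps + 1) + delta.
Proof.
  intros GX M Hl He Q Ht Hmin Ip Ib u Hu delta Hd.
  destruct (Morse_center N I c lam eps (- b) (- a) (fun t => q (- t)) (- t) p GX M Hl He)
    with (u := - u) (delta := delta) as [s Hs]; rewrite ?Ropp_involutive in *;
    try easy; try lra.
  - apply qg_reverse; easy.
  - intros s Hs. apply Hmin. lra.
  - exists s. easy.
Qed.

(** * Gluing two Morse paths at a common point *)

Definition join_gauge (N1 N2 : R -> R -> R) : R -> R -> R := fun lam eps =>
  N1 lam eps + N2 lam eps + N1 (3 * lam) (eps + 1) + N2 (3 * lam) (eps + 1).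

Lemma join_gauge_Morse N1 N2 :
  Morse_gauge N1 -> Morse_gauge N2 -> Morse_gauge (join_gauge N1 N2).
Proof.
  intros H1 H2 lam eps Hl He. unfold join_gauge.
  pose proof (H1 lam eps Hl He). pose proof (H2 lam eps Hl He).
  pose proof (H1 (3 * lam) (eps + 1) ltac:(lra) ltac:(lra)).
  pose proof (H2 (3 * lam) (eps + 1) ltac:(lra) ltac:(lra)). lra.
Qed.

(** The quasi-geodesic is cut at a point almost closest to the corner [c u]. Closing each part with
    a geodesic to the corner puts both of its ends on one side, which is why the gauges are taken at
    [3 * lam] and [eps + 1]. *)
Lemma Morse_join_crossing {X : MetricSpace} N1 N2 I1 I2 (c : R -> X) u lam eps a b q :
  geodesic_space X -> N_Morse X N1 I1 c -> N_Morse X N2 I2 c -> I1 u -> I2 u ->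
  1 <= lam -> 0 <= eps -> quasi_geodesic X lam eps a b q ->
  (exists s, I1 s /\ q a = c s) -> (exists s, I2 s /\ q b = c s) ->
  forall t, a <= t <= b -> forall delta, 0 < delta ->
    (exists s, I1 s /\ mdist (q t) (c s) < N1 (3 * lam) (eps + 1) + delta) \/
    (exists s, I2 s /\ mdist (q t) (c s) < N2 (3 * lam) (eps + 1) + delta).
Proof.
  intros GX M1 M2 u1 u2 Hl He Q Ha Hb t Ht delta Hd.
  pose proof Q as [ab _].
  destruct (near_min (fun s => a <= s <= b) (fun s => mdist (q s) (c u)) a)
    as [m [Hm Hmin]]; [lra|intros; apply mdist_nonneg|].
  destruct (Rle_dec t m).
  - left. apply (Morse_center N1 I1 c lam eps a b q m (c u)); try easy.
    exists u. easy.
  - right. apply (Morse_center_r N2 I2 c lam eps a b q m (c u)); try easy; try lra.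
    exists u. easy.
Qed.

Lemma Morse_join {X : MetricSpace} N1 N2 I1 I2 (c : R -> X) u :
  geodesic_space X -> Morse_gauge N1 -> Morse_gauge N2 ->
  N_Morse X N1 I1 c -> N_Morse X N2 I2 c -> I1 u -> I2 u ->
  N_Morse X (join_gauge N1 N2) (fun s => I1 s \/ I2 s) c.
Proof.
  intros GX H1 H2 M1 M2 u1 u2 lam eps a b q Hl He Q [sa [[Ia|Ia] Ea]] [sb [[Ib|Ib] Eb]]
    t Ht delta Hd;
  pose proof (H1 lam eps Hl He); pose proof (H2 lam eps Hl He);
  pose proof (H1 (3 * lam) (eps + 1) ltac:(lra) ltac:(lra));
  pose proof (H2 (3 * lam) (eps + 1) ltac:(lra) ltac:(lra)); unfold join_gauge.
  - destruct (M1 lam eps a b q Hl He Q) with (t := t) (delta := delta) as [s [Is ds]]; eauto.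
    exists s. split; [tauto|lra].
  - destruct (Morse_join_crossing N1 N2 I1 I2 c u lam eps a b q) with (t := t) (delta := delta)
      as [[s [Is ds]]|[s [Is ds]]]; eauto; exists s; (split; [tauto|lra]).
  - destruct (Morse_join_crossing N2 N1 I2 I1 c u lam eps a b q) with (t := t) (delta := delta)
      as [[s [Is ds]]|[s [Is ds]]]; eauto; exists s; (split; [tauto|lra]).
  - destruct (M2 lam eps a b q Hl He Q) with (t := t) (delta := delta) as [s [Is ds]]; eauto.
    exists s. split; [tauto|lra].
Qed.

(** * Asymptotic rays and points of the boundary *)

Definition asym_const (N : R -> R -> R) : R := 2 * (N 3 1 + 1).

Lemma asym_const_nonneg N : Morse_gauge N -> 0 <= asym_const N.
Proof. intros H. pose proof (H 3 1 ltac:(lra) ltac:(lra)). unfold asym_const. lra. Qed.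

(* The bound does not involve the Hausdorff distance of the two rays. *)
Lemma asymptotic_close {X : MetricSpace} x0 N (alpha beta : R -> X) :
  geodesic_space X -> Morse_gauge N -> N_Morse_ray X x0 N alpha ->
  geodesic_ray X beta -> beta 0 = x0 -> hfin X alpha beta ->
  forall t, 0 <= t -> mdist (beta t) (alpha t) <= asym_const N.
Proof.
  intros GX HN [Ga [A0 M]] Gb B0 [C [HC _]] t Ht. unfold asym_const.
  assert (C0 : 0 <= C).
  { destruct (HC 0 ltac:(lra)) as [s [_ ds]].
    pose proof (mdist_nonneg (alpha 0) (beta s)). lra. }
  (* A point [beta m] almost closest to [alpha T] is within [C + 1] of it, so this choice of [T]
     forces [t <= m]. *)
  set (T := t + C + 1).
  destruct (near_min nonneg (fun s => mdist (beta s) (alpha T)) 0) as [m [Hm Hmin]];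
    [unfold nonneg; lra|intros; apply mdist_nonneg|].
  unfold nonneg in *.
  assert (tm : t <= m).
  { destruct (HC T ltac:(unfold T; lra)) as [s [Hs ds]].
    rewrite mdist_sym in ds. specialize (Hmin s Hs).
    pose proof (mdist_tri X (alpha 0) (beta m) (alpha T)) as TR.
    rewrite A0 in TR. rewrite <- B0 in TR at 2. rewrite geodesic_ray_dist0 in TR by easy.
    rewrite <- A0 in TR. rewrite geodesic_ray_dist0 in TR by (easy || unfold T; lra).
    unfold T in *; lra. }
  destruct (Morse_center N nonneg alpha 1 0 0 m beta m (alpha T) GX M ltac:(lra) ltac:(lra))
    with (u := t) (delta := 1) as [s [Is ds]]; try lra.
  - apply qg_of_geodesic; [lra|]. intros; apply Gb; lra.
  - intros s Hs. apply Hmin; lra.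
  - exists T. split; [unfold nonneg, T; lra|easy].
  - exists 0. split; [unfold nonneg; lra|]. congruence.
  - rewrite Rmult_1_r, Rplus_0_l in ds. unfold nonneg in Is.
    (* Parameters on both rays are distances to [x0], so [s] and [t] differ by at most the distance
       from [alpha s] to [beta t]. This gives the factor 2 in [asym_const]. *)
    assert (D : mdist (alpha s) (alpha t) <= N 3 1 + 1).
    { rewrite Ga by easy.
      replace (s - t) with (mdist x0 (alpha s) - mdist x0 (beta t)).
      - pose proof (mdist_close x0 x0 (alpha s) (beta t)) as CL.
        rewrite mdist_self, (mdist_sym X (alpha s)) in CL. lra.
      - rewrite <- A0 at 1. rewrite <- B0, !geodesic_ray_dist0; easy. }
    pose proof (mdist_tri X (beta t) (alpha s) (alpha t)). lra.
Qed.

Definition asym_gauge (N : R -> R -> R) : R -> R -> R := close_gauge N (asym_const N).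

Lemma Morse_ray_close {X : MetricSpace} x0 N (alpha beta : R -> X) D :
  Morse_gauge N -> 0 <= D -> N_Morse X N nonneg alpha ->
  geodesic_ray X beta -> beta 0 = x0 ->
  (forall t, 0 <= t -> mdist (beta t) (alpha t) <= D) ->
  N_Morse_ray X x0 (close_gauge N D) beta.
Proof.
  intros HN HD Ha Gb B0 H. split; [easy|]. split; [easy|].
  apply (Morse_close N nonneg nonneg alpha beta D); try easy;
    intros s Hs; exists s; (split; [easy|]); rewrite mdist_sym; apply H; easy.
Qed.

(** Controls every representative of a point of the stratum of [N], and not just an [N]-Morse one,
    by a gauge that depends on [N] alone. *)
Lemma asymptotic_Morse {X : MetricSpace} x0 N (alpha beta : R -> X) :
  geodesic_space X -> Morse_gauge N -> N_Morse_ray X x0 N alpha ->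
  geodesic_ray X beta -> beta 0 = x0 -> hfin X alpha beta ->
  N_Morse_ray X x0 (asym_gauge N) beta.
Proof.
  intros GX HN Ha Gb B0 H. apply (Morse_ray_close x0 N alpha); try easy.
  - apply asym_const_nonneg; easy.
  - apply Ha.
  - apply (asymptotic_close x0); easy.
Qed.

Lemma hfin_pointwise {X : MetricSpace} (a b : R -> X) C :
  (forall t, 0 <= t -> mdist (a t) (b t) <= C) -> hfin X a b.
Proof. intros H. exists C. split; intros t Ht; exists t; auto. Qed.

Lemma hfin_sym {X : MetricSpace} (a b : R -> X) : hfin X a b -> hfin X b a.
Proof.
  intros [C [H1 H2]]. exists C. split; intros t Ht.
  - destruct (H2 t Ht) as [s [Hs ds]]. exists s. rewrite mdist_sym. easy.
  - destruct (H1 t Ht) as [s [Hs ds]]. exists s. rewrite mdist_sym. easy.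
Qed.

Lemma hfin_trans {X : MetricSpace} (a b c : R -> X) :
  hfin X a b -> hfin X b c -> hfin X a c.
Proof.
  intros [C [H1 H2]] [C' [H1' H2']]. exists (C + C'). split; intros t Ht.
  - destruct (H1 t Ht) as [s [Hs ds]]. destruct (H1' s Hs) as [r [Hr dr]].
    exists r. split; [easy|]. pose proof (mdist_tri X (a t) (b s) (c r)). lra.
  - destruct (H2' t Ht) as [s [Hs ds]]. destruct (H2 s Hs) as [r [Hr dr]].
    exists r. split; [easy|]. pose proof (mdist_tri X (a r) (b s) (c t)). lra.
Qed.

Lemma hfin_refl {X : MetricSpace} (a : R -> X) : hfin X a a.
Proof. apply (hfin_pointwise a a 0). intros. rewrite mdist_self. lra. Qed.

Lemma hfin_isometry {X : MetricSpace} (g : X -> X) (a b : R -> X) :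
  isometry X g -> hfin X a b -> hfin X (fun t => g (a t)) (fun t => g (b t)).
Proof.
  intros Hg [C [H1 H2]]. exists C.
  split; intros t Ht; [destruct (H1 t Ht) as [s Hs]|destruct (H2 t Ht) as [s Hs]];
    exists s; rewrite Hg; easy.
Qed.

Lemma mclass_self {X : MetricSpace} (x0 : X) a : Morse_ray X x0 a -> mclass X x0 a a.
Proof. intros H. split; [easy|apply hfin_refl]. Qed.

(** Boundary points are predicates on rays, so their equality rests on functional and propositional
    extensionality. *)
Lemma set_ext {T : Type} (P Q : T -> Prop) : (forall f, P f <-> Q f) -> P = Q.
Proof. intros H. apply boolp.funext. intros f. apply boolp.propext. apply H. Qed.

Lemma mclass_eq {X : MetricSpace} (x0 : X) a b : hfin X a b -> mclass X x0 a = mclass X x0 b.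
Proof.
  intros H. apply set_ext. intros f. split; intros [M Hf]; (split; [easy|]).
  - apply hfin_trans with a; [apply hfin_sym|]; easy.
  - apply hfin_trans with b; easy.
Qed.

Lemma boundary_pt_eq {X : MetricSpace} (x0 : X) P a :
  boundary_pt X x0 P -> P a -> Morse_ray X x0 a /\ P = mclass X x0 a.
Proof.
  intros [b [Mb ->]] [Ma H]. split; [easy|]. apply mclass_eq; easy.
Qed.

Lemma boundary_pt_ex {X : MetricSpace} (x0 : X) P : boundary_pt X x0 P -> exists a, P a.
Proof. intros [b [Mb ->]]. exists b. apply mclass_self; easy. Qed.

(** * Ultralimits *)

(** Limits along a free ultrafilter replace the extraction of diagonal subsequences. The field
    [uf_ex] expresses properness and [uf_tail] freeness. *)
Record free_ultrafilter (w : (nat -> Prop) -> Prop) : Prop := {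
  uf_mono : forall A B : nat -> Prop, (forall n, A n -> B n) -> w A -> w B;
  uf_and : forall A B : nat -> Prop, w A -> w B -> w (fun n => A n /\ B n);
  uf_or_not : forall A : nat -> Prop, w A \/ w (fun n => ~ A n);
  uf_tail : forall n0, w (fun n => (n0 <= n)%nat);
  uf_ex : forall A : nat -> Prop, w A -> exists n, A n }.

Lemma free_ultrafilter_ex : exists w, free_ultrafilter w.
Proof.
  destruct (@filter.ultraFilterLemma nat filter.eventually filter.eventually_filter)
    as [w [U sub]].
  pose proof (@filter.ultra_proper _ _ U) as P.
  pose proof (@filter.filter_filter _ _ P) as F.
  exists w. split.
  - intros A B AB. apply (@filter.filterS _ _ F A B AB).
  - intros A B. apply (@filter.filterI _ _ F A B).
  - intros A. apply (@filter.in_ultra_setVsetC _ w A U).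
  - intros n0. apply sub. exists n0; [easy|]. intros n Hn.
    apply (ssrbool.elimT ssrnat.leP Hn).
  - intros A. apply (@filter.filter_ex _ _ P).
Qed.

Lemma uf_and_list {T : Type} w (A : T -> nat -> Prop) (l : list T) :
  free_ultrafilter w -> (forall x, In x l -> w (A x)) ->
  w (fun n => forall x, In x l -> A x n).
Proof.
  intros W. induction l as [|x l IH]; intros H.
  - apply (uf_mono w W (fun n => (0 <= n)%nat)); [easy|apply (uf_tail w W)].
  - apply (uf_mono w W (fun n => A x n /\ forall y, In y l -> A y n)).
    + intros n [Hx Hl] y [<-|Hy]; auto.
    + apply (uf_and w W); [apply H; now left|apply IH; intros; apply H; now right].
Qed.

Lemma uf_of_tail w (A : nat -> Prop) n0 :
  free_ultrafilter w -> (forall n, (n0 <= n)%nat -> A n) -> w A.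
Proof. intros W H. apply (uf_mono w W _ A H). apply (uf_tail w W). Qed.

Definition ulim {X : MetricSpace} (w : (nat -> Prop) -> Prop) (x : nat -> X) (y : X) : Prop :=
  forall eps, 0 < eps -> w (fun n => mdist (x n) y < eps).

Lemma metric_ball_open {X : MetricSpace} (x : X) r : metric_open mdist (fun y => mdist y x < r).
Proof.
  intros y Hy. exists (r - mdist y x). split; [lra|]. intros z Hz.
  pose proof (mdist_tri X z y x). rewrite (mdist_sym X z y) in *. lra.
Qed.

(** If no point were an ultralimit, every point would have a ball avoided by [x n] for almost all
    [n]. Finitely many such balls cover the compact ball about [x0], which contains [x n] for almost
    all [n]. *)
Lemma ulim_ex {X : MetricSpace} w (x : nat -> X) (x0 : X) r :
  proper_space X -> free_ultrafilter w -> w (fun n => mdist x0 (x n) <= r) ->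
  exists y, ulim w x y.
Proof.
  intros PX W Hr. apply NNPP. intros none.
  destruct (PX x0 r (fun O => metric_open mdist O /\ w (fun n => ~ O (x n))))
    as [l [lC lcov]].
  - easy.
  - intros y _. apply NNPP. intros noO. apply none. exists y. intros eps He.
    destruct (uf_or_not w W (fun n => mdist (x n) y < eps)) as [|H]; [easy|].
    exfalso. apply noO. exists (fun z => mdist z y < eps). split.
    + split; [apply metric_ball_open|easy].
    + rewrite mdist_self. easy.
  - pose proof (uf_and_list w (fun (O : X -> Prop) n => ~ O (x n)) l W) as H.
    destruct (uf_ex w W _ (uf_and w W _ _ Hr (H (fun O i => proj2 (lC O i)))))
      as [n [Hn Hl]].
    destruct (lcov (x n) Hn) as [O [Ol OO]]. exact (Hl O Ol OO).
Qed.

Lemma ulim_dist {X : MetricSpace} w (x x' : nat -> X) y y' :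
  free_ultrafilter w -> ulim w x y -> ulim w x' y' ->
  forall eps, 0 < eps -> w (fun n => Rabs (mdist (x n) (x' n) - mdist y y') < eps).
Proof.
  intros W H H' eps He.
  apply (uf_mono w W (fun n => mdist (x n) y < eps / 2 /\ mdist (x' n) y' < eps / 2)).
  - intros n [h h']. pose proof (mdist_close (x n) y (x' n) y'). lra.
  - apply (uf_and w W); [apply H|apply H']; lra.
Qed.

Lemma ulim_const {X : MetricSpace} w (y : X) : free_ultrafilter w -> ulim w (fun _ => y) y.
Proof.
  intros W eps He. apply (uf_of_tail w _ 0 W). intros n _. rewrite mdist_self. easy.
Qed.

Lemma ulim_dist_le {X : MetricSpace} w (x x' : nat -> X) y y' r :
  free_ultrafilter w -> ulim w x y -> ulim w x' y' ->
  w (fun n => mdist (x n) (x' n) <= r) -> mdist y y' <= r.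
Proof.
  intros W H H' Hr. apply Rnot_lt_le. intros lt.
  pose proof (ulim_dist w x x' y y' W H H' (mdist y y' - r) ltac:(lra)) as D.
  destruct (uf_ex w W _ (uf_and w W _ _ Hr D)) as [n [h1 h2]].
  apply Rabs_def2 in h2. lra.
Qed.

Lemma ulim_dist_eq {X : MetricSpace} w (x x' : nat -> X) y y' r :
  free_ultrafilter w -> ulim w x y -> ulim w x' y' ->
  w (fun n => mdist (x n) (x' n) = r) -> mdist y y' = r.
Proof.
  intros W H H' Hr. apply NNPP. intros ne.
  assert (P : 0 < Rabs (r - mdist y y')) by (apply Rabs_pos_lt; lra).
  destruct (uf_ex w W _ (uf_and w W _ _ Hr (ulim_dist w x x' y y' W H H' _ P)))
    as [n [h1 h2]].
  rewrite h1 in h2. lra.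
Qed.

(** A substitute for Arzela-Ascoli that takes the limit pointwise. The distance condition is asked
    on each [[0, T]] for almost all indices only, which admits segments whose lengths tend to
    infinity. *)
Lemma ulim_ray {X : MetricSpace} w (x0 : X) (f : nat -> R -> X) :
  proper_space X -> free_ultrafilter w -> (forall n, f n 0 = x0) ->
  (forall T, 0 <= T -> w (fun n => forall s t, 0 <= s <= T -> 0 <= t <= T ->
     mdist (f n s) (f n t) = Rabs (s - t))) ->
  exists b, geodesic_ray X b /\ b 0 = x0 /\ forall t, 0 <= t -> ulim w (fun n => f n t) (b t).
Proof.
  intros PX W f0 G.
  (* Negative times carry no condition, and [x0] serves as a default there. *)
  assert (L : forall t, exists y, 0 <= t -> ulim w (fun n => f n t) y).
  { intros t. destruct (Rle_dec 0 t) as [Ht|Ht]; [|exists x0; easy].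
    destruct (ulim_ex w (fun n => f n t) x0 t PX W) as [y Hy]; [|exists y; easy].
    eapply (uf_mono w W); [|apply (G t Ht)]. intros n H. simpl in H.
    rewrite <- (f0 n), H by lra. rewrite Rabs_left1; lra. }
  destruct (boolp.choice L) as [b Hb]. exists b.
  split; [|split; [|easy]].
  - intros s t Hs Ht.
    apply (ulim_dist_eq w _ _ _ _ _ W (Hb s Hs) (Hb t Ht)).
    pose proof (Rmax_l s t). pose proof (Rmax_r s t).
    eapply (uf_mono w W); [|apply (G (Rmax s t)); lra].
    intros n H1. apply H1; lra.
  - apply mdist_eq0.
    apply (ulim_dist_eq w _ _ _ _ _ W (Hb 0 ltac:(lra)) (ulim_const w x0 W)).
    apply (uf_of_tail w _ 0 W). intros n _. rewrite f0. apply mdist_self.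
Qed.

(** * Compact subsets of the Morse boundary *)

Definition co_nbhd {X : MetricSpace} (f : R -> X) (A : (R -> X) -> Prop) : Prop :=
  exists l : list ((R -> X) -> Prop),
    (forall S, In S l -> co_subbasic X S) /\ (forall S, In S l -> S f) /\
    (forall h, (forall S, In S l -> S h) -> A h).

Lemma co_nbhd_self {X : MetricSpace} (f : R -> X) A : co_nbhd f A -> A f.
Proof. intros [l [_ [H1 H2]]]. auto. Qed.

Lemma co_nbhd_mono {X : MetricSpace} (f : R -> X) (A B : (R -> X) -> Prop) :
  (forall h, A h -> B h) -> co_nbhd f A -> co_nbhd f B.
Proof. intros AB [l [H [H1 H2]]]. exists l. auto. Qed.

Lemma co_nbhd_and {X : MetricSpace} (f : R -> X) (A B : (R -> X) -> Prop) :
  co_nbhd f A -> co_nbhd f B -> co_nbhd f (fun h => A h /\ B h).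
Proof.
  intros [l [H [H1 H2]]] [l' [H' [H1' H2']]]. exists (l ++ l').
  split; [|split].
  - intros S HS. apply in_app_or in HS. destruct HS; [apply H|apply H']; easy.
  - intros S HS. apply in_app_or in HS. destruct HS; [apply H1|apply H1']; easy.
  - intros h Hh. split; [apply H2|apply H2']; intros S HS; apply Hh, in_or_app; auto.
Qed.

Lemma co_nbhd_all {X : MetricSpace} (f : R -> X) (A : (R -> X) -> Prop) :
  (forall h, A h) -> co_nbhd f A.
Proof. intros H. exists nil. split; [|split]; easy. Qed.

Lemma co_nbhd_at {X : MetricSpace} (f : R -> X) t r :
  0 <= t -> 0 < r -> co_nbhd f (fun h => mdist (h t) (f t) < r).
Proof.
  intros Ht Hr. exists ((fun h => forall s, s = t -> mdist (h s) (f t) < r) :: nil).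
  split; [|split].
  - intros S [<-|[]]. exists (fun s => s = t), (fun y => mdist y (f t) < r).
    split; [intros; lra|]. split; [|split; [apply metric_ball_open|easy]].
    intros C _ cov. destruct (cov t eq_refl) as [O [CO Ot]]. exists (O :: nil). split.
    + intros O' [<-|[]]. easy.
    + intros x ->. exists O. split; [now left|easy].
  - intros S [<-|[]] s ->. rewrite mdist_self. easy.
  - intros h H. exact (H _ (or_introl eq_refl) t eq_refl).
Qed.

Lemma co_nbhd_open {X : MetricSpace} (A : (R -> X) -> Prop) : co_open X (fun f => co_nbhd f A).
Proof.
  intros f [l [H [H1 H2]]]. exists l. split; [easy|]. split; [easy|].
  intros h Hh. exists l. easy.
Qed.

(** Reduces openness to a check ray by ray: the open set of maps demanded by [stratum_open] is the
    interior of the set of those [h] which, if [N]-Morse, represent a point of [W]. *)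
Lemma boundary_open_intro {X : MetricSpace} (x0 : X) (W : ((R -> X) -> Prop) -> Prop) :
  (forall P, W P -> boundary_pt X x0 P) ->
  (forall N f, Morse_gauge N -> N_Morse_ray X x0 N f -> W (mclass X x0 f) ->
     co_nbhd f (fun h => N_Morse_ray X x0 N h -> W (mclass X x0 h))) ->
  boundary_open X x0 W.
Proof.
  intros HW H. split; [easy|]. intros N HN. split; [easy|].
  exists (fun f => co_nbhd f (fun h => N_Morse_ray X x0 N h -> W (mclass X x0 h))).
  split; [apply co_nbhd_open|]. intros a Ha. split.
  - intros [Wa _]. apply H; easy.
  - intros C. pose proof (co_nbhd_self _ _ C Ha) as Wa. split; [easy|].
    split; [auto|]. exists a. split; [easy|]. apply mclass_self. exists N. easy.
Qed.

(* Points of a stratum are closed, since asymptotic rays of a fixed gauge are uniformly close. *)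
Lemma co_nbhd_avoid {X : MetricSpace} (x0 : X) N f P :
  geodesic_space X -> Morse_gauge N -> N_Morse_ray X x0 N f -> mclass X x0 f <> P ->
  co_nbhd f (fun h => N_Morse_ray X x0 N h -> mclass X x0 h <> P).
Proof.
  intros GX HN Hf fP.
  destruct (classic (exists a, N_Morse_ray X x0 N a /\ mclass X x0 a = P)) as [[a [Ha <-]]|no].
  (* The margin 1 is the radius of the neighbourhood of [f]. A ray [h] in it and in the class of [a]
     would be within [asym_const N] of [a] at time [t]. *)
  - assert (exists t, 0 <= t /\ asym_const N + 1 < mdist (f t) (a t)) as [t [Ht far]].
    { apply NNPP. intros no. apply fP, mclass_eq.
      apply (hfin_pointwise f a (asym_const N + 1)). intros t Ht. apply Rnot_lt_le.
      intros lt. apply no. exists t. easy. }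
    apply (co_nbhd_mono f (fun h => mdist (h t) (f t) < 1)); [|apply co_nbhd_at; lra].
    intros h ht Hh E.
    assert (ah : hfin X a h).
    { assert (M : mclass X x0 h h) by (apply mclass_self; exists N; easy).
      rewrite E in M. apply M. }
    pose proof (asymptotic_close x0 N a h GX HN Ha (proj1 Hh) (proj1 (proj2 Hh)) ah t Ht).
    pose proof (mdist_tri X (f t) (h t) (a t)). rewrite (mdist_sym X (f t) (h t)) in *. lra.
  - apply co_nbhd_all. intros h Hh E. apply no. exists h. easy.
Qed.

(* Since [P n] can only accumulate at [p], each set consisting of [p] and all [P n] with [n >= m] is closed, and the complements cover the compact set [K]. *)
Lemma compact_escape {X : MetricSpace} (x0 : X) (K : ((R -> X) -> Prop) -> Prop) p P :
  geodesic_space X ->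
  (forall Q, K Q -> boundary_pt X x0 Q) -> compact_in (boundary_open X x0) K -> ~ K p ->
  (forall n : nat, K (P n)) ->
  (forall N f, Morse_gauge N -> N_Morse_ray X x0 N f -> mclass X x0 f <> p ->
     exists n0, co_nbhd f (fun h => N_Morse_ray X x0 N h ->
       forall n, (n0 <= n)%nat -> mclass X x0 h <> P n)) ->
  False.
Proof.
  intros GX KB CK Kp KP Hesc.
  set (O := fun (m : nat) Q => boundary_pt X x0 Q /\ Q <> p /\
              forall n, (m <= n)%nat -> Q <> P n).
  assert (Oopen : forall m, boundary_open X x0 (O m)).
  { intros m. apply boundary_open_intro; [intros Q HQ; apply HQ|].
    intros N f HN Hf [Bf [fp fP]].
    destruct (Hesc N f HN Hf fp) as [n0 C0].
    (* The hypothesis handles the indices from [n0] on. The finitely many earlier ones are excluded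
       one at a time, as each [P j] is closed in the stratum. *)
    assert (C1 : forall j, co_nbhd f (fun h => N_Morse_ray X x0 N h ->
        forall n, (m <= n < j)%nat -> mclass X x0 h <> P n)).
    { induction j as [|j IH].
      - apply co_nbhd_all. intros; lia.
      - destruct (Nat.le_gt_cases m j) as [mj|jm].
        + eapply co_nbhd_mono;
            [|apply (co_nbhd_and f _ _ IH (co_nbhd_avoid x0 N f (P j) GX HN Hf (fP j mj)))].
          intros h [H1 H2] Hh n Hn.
          destruct (Nat.eq_dec n j) as [->|]; [auto|]. apply H1; [easy|lia].
        + apply co_nbhd_all. intros; lia. }
    pose proof (co_nbhd_and f _ _ C0 (co_nbhd_and f _ _ (C1 n0)
      (co_nbhd_avoid x0 N f p GX HN Hf fp))) as C.
    revert C. apply co_nbhd_mono. intros h [H0 [H1 H2]] Hh. split; [|split; [auto|]].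
    - exists h. split; [exists N; easy|easy].
    - intros n Hn. destruct (Nat.le_gt_cases n0 n); [apply H0; easy|apply H1; easy]. }
  destruct (CK (fun W => exists m, W = O m)) as [l [lO lcov]].
  - intros W [m ->]. apply Oopen.
  - intros Q KQ. destruct (KB Q KQ) as [a [[N [HN Ha]] E]].
    destruct (Hesc N a HN Ha) as [n0 C]; [congruence|].
    exists (O n0). split; [exists n0; easy|]. split; [auto|]. split; [congruence|].
    rewrite E. apply (co_nbhd_self _ _ C Ha).
  (* The sets [O m] increase with [m], so a finite subcover lies in a single [O M]. This set misses
     [P M], which is a point of [K]. *)
  - assert (exists M, forall W, In W l -> forall Q, W Q -> O M Q) as [M HM].
    { clear lcov. induction l as [|W l IH].
      - exists 0%nat. easy.
      - destruct IH as [M HM]; [intros; apply lO; now right|].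
        destruct (lO W (or_introl eq_refl)) as [m ->].
        exists (max m M). intros W' [<-|HW'] Q HQ.
        + destruct HQ as [H1 [H2 H3]]. split; [easy|]. split; [easy|].
          intros n Hn. apply H3. lia.
        + destruct (HM W' HW' Q HQ) as [H1 [H2 H3]]. split; [easy|]. split; [easy|].
          intros n Hn. apply H3. lia. }
    destruct (lcov (P M) (KP M)) as [W [Wl WP]].
    destruct (HM W Wl _ WP) as [_ [_ H]]. exact (H M (le_n M) eq_refl).
Qed.

(** For fixed [lam] and [eps], suppose that no constant serves all representatives of points of [K],
    and let [P n] violate the constant [n]. A stratum [N] contains no [P n] with [n] above
    [asym_gauge N lam eps], so the sequence escapes every stratum, against compactness. The
    constants for all pairs form the gauge. *)
Lemma compact_stratum {X : MetricSpace} (x0 : X) (K : ((R -> X) -> Prop) -> Prop) p :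
  geodesic_space X ->
  (forall Q, K Q -> boundary_pt X x0 Q) -> compact_in (boundary_open X x0) K -> ~ K p ->
  exists N, Morse_gauge N /\ forall P a, K P -> P a -> N_Morse_ray X x0 N a.
Proof.
  intros GX KB CK Kp.
  set (bound := fun lam eps C (P : (R -> X) -> Prop) =>
    forall c a b (q : R -> X), P c -> quasi_geodesic X lam eps a b q ->
    (exists s, nonneg s /\ q a = c s) -> (exists s, nonneg s /\ q b = c s) ->
    forall t, a <= t <= b ->
      forall delta, 0 < delta -> exists s, nonneg s /\ mdist (q t) (c s) < C + delta).
  assert (H : forall le : R * R, exists n : nat, 1 <= fst le -> 0 <= snd le ->
             forall P, K P -> bound (fst le) (snd le) (INR n) P).
  { intros [lam eps]. simpl. apply NNPP. intros no.
    assert (bad : forall n : nat, exists P, K P /\ ~ bound lam eps (INR n) P).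
    { intros n. apply NNPP. intros H. apply no. exists n. intros _ _ P KP.
      apply NNPP. intros HP. apply H. exists P. easy. }
    destruct (Rle_dec 1 lam) as [Hl|Hl]; [|apply no; exists 0%nat; easy].
    destruct (Rle_dec 0 eps) as [He|He]; [|apply no; exists 0%nat; easy].
    destruct (boolp.choice bad) as [P HP].
    apply (compact_escape x0 K p P GX KB CK Kp); [intros n; apply HP|].
    intros N f HN Hf _. destruct (INR_unbounded (asym_gauge N lam eps)) as [n0 Hn0].
    exists n0. apply co_nbhd_all. intros h Hh n Hn E. apply (proj2 (HP n)).
    rewrite <- E. intros c a b q [[Nc [_ Hc]] hc] Q Ea Eb t Ht delta Hd.
    destruct (asymptotic_Morse x0 N h c GX HN Hh) as [_ [_ M]]; try apply Hc; [easy|].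
    destruct (M lam eps a b q Hl He Q Ea Eb t Ht delta Hd) as [s [Is ds]].
    exists s. split; [easy|]. apply le_INR in Hn. lra. }
  destruct (boolp.choice H) as [nu Hnu].
  exists (fun lam eps => INR (nu (lam, eps))). split.
  - intros lam eps _ _. apply pos_INR.
  - intros P c KP Pc. destruct (boundary_pt_eq x0 P c (KB P KP) Pc) as [[Nc [_ Hc]] _].
    split; [apply Hc|]. split; [apply Hc|].
    intros lam eps a b q Hl He. exact (Hnu (lam, eps) Hl He P KP c a b q Pc).
Qed.

(** Geodesic rays are 1-Lipschitz, so closeness at one time persists on a short interval around it.
    Finitely many such intervals cover [C], which turns pointwise convergence into compact-open
    convergence. *)
Lemma ulim_co_subbasic {X : MetricSpace} w (b : nat -> R -> X) f S :
  free_ultrafilter w -> (forall n, geodesic_ray X (b n)) ->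
  (forall t, 0 <= t -> ulim w (fun n => b n t) (f t)) ->
  co_subbasic X S -> S f -> w (fun n => S (b n)).
Proof.
  intros W G L [C [V [C0 [CC [VO ->]]]]] Sf.
  destruct (CC (fun O => metric_open Rdist O /\
      w (fun n => forall s, 0 <= s -> O s -> V (b n s)))) as [l [lO lcov]].
  - easy.
  - intros t Ct. destruct (VO (f t) (Sf t Ct)) as [r [Hr Vr]].
    exists (fun s => Rdist t s < r / 2). split; [split|].
    + intros s Hs. exists (r / 2 - Rdist t s). split; [lra|]. intros u Hu.
      unfold Rdist in *. pose proof (Rabs_triang (t - s) (s - u)) as T.
      replace (t - s + (s - u)) with (t - u) in T by ring. lra.
    + apply (uf_mono w W (fun n => mdist (b n t) (f t) < r / 2)).
      * intros n Hn s Hs Hts. apply Vr.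
        pose proof (mdist_tri X (f t) (b n t) (b n s)) as T.
        rewrite (mdist_sym X (f t) (b n t)) in T. rewrite (G n t s (C0 t Ct) Hs) in T.
        unfold Rdist in Hts. lra.
      * apply L; [auto|lra].
    + unfold Rdist. rewrite Rminus_diag, Rabs_R0. lra.
  - apply (uf_mono w W (fun n => forall O, In O l -> forall s, 0 <= s -> O s -> V (b n s))).
    + intros n Hn t Ct. destruct (lcov t Ct) as [O [Ol Ot]]. apply (Hn O Ol); auto.
    + apply (uf_and_list w (fun (O : R -> Prop) n => forall s, 0 <= s -> O s -> V (b n s)) l W).
      intros O Ol. apply (lO O Ol).
Qed.

(** An open set of the direct limit is open in each stratum, so pointwise convergence suffices once
    all rays and their limit share one gauge. *)
Lemma ulim_boundary_open {X : MetricSpace} (x0 : X) w (b : nat -> R -> X) f N U :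
  free_ultrafilter w -> Morse_gauge N ->
  (forall n, N_Morse_ray X x0 N (b n)) -> N_Morse_ray X x0 N f ->
  (forall t, 0 <= t -> ulim w (fun n => b n t) (f t)) ->
  boundary_open X x0 U -> U (mclass X x0 f) -> w (fun n => U (mclass X x0 (b n))).
Proof.
  intros W HN Hb Hf L [UB UO] Uf. destruct (UO N HN) as [_ [O [OO HO]]].
  assert (Of : O f).
  { apply HO; [easy|]. split; [easy|]. split; [auto|]. exists f. split; [easy|].
    apply mclass_self. exists N. easy. }
  destruct (OO f Of) as [l [lS [lf lO]]].
  apply (uf_mono w W (fun n => forall S, In S l -> S (b n))).
  - intros n Hn. apply (proj2 (HO (b n) (Hb n)) (lO (b n) Hn)).
  - apply (uf_and_list w (fun (S : (R -> X) -> Prop) n => S (b n)) l W).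
    intros S Sl. apply (ulim_co_subbasic w b f S); auto.
    + intros n. apply Hb.
    + apply lf. easy.
Qed.

(** * Translates of Morse rays *)

Lemma isometry_inverse {X : MetricSpace} (g ginv : X -> X) :
  isometry X g -> (forall x, g (ginv x) = x) -> isometry X ginv.
Proof. intros Hg gK x y. rewrite <- Hg, !gK. easy. Qed.

Lemma N_Morse_isometry {X : MetricSpace} (g ginv : X -> X) N I c :
  isometry X g -> (forall x, g (ginv x) = x) -> (forall x, ginv (g x) = x) ->
  N_Morse X N I c -> N_Morse X N I (fun t => g (c t)).
Proof.
  intros Hg gK ginvK M lam eps a b q Hl He [ab Q] [sa [Ia Ea]] [sb [Ib Eb]] t Ht delta Hd.
  pose proof (isometry_inverse g ginv Hg gK) as Hi.
  destruct (M lam eps a b (fun t => ginv (q t)) Hl He) with (t := t) (delta := delta)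
    as [s [Is ds]]; try easy.
  - split; [easy|]. intros. rewrite Hi. apply Q; easy.
  - exists sa. rewrite Ea, ginvK. easy.
  - exists sb. rewrite Eb, ginvK. easy.
  - exists s. split; [easy|]. rewrite <- Hi, ginvK. easy.
Qed.

Lemma N_Morse_weaken {X : MetricSpace} N N' I (c : R -> X) :
  (forall lam eps, 1 <= lam -> 0 <= eps -> N lam eps <= N' lam eps) ->
  N_Morse X N I c -> N_Morse X N' I c.
Proof.
  intros H M lam eps a b q Hl He Q Ha Hb t Ht delta Hd.
  destruct (M lam eps a b q Hl He Q Ha Hb t Ht delta Hd) as [s [Is ds]].
  exists s. specialize (H lam eps Hl He). split; [easy|lra].
Qed.

Lemma travel_const_nonneg N D : Morse_gauge N -> 0 <= D -> 0 <= travel_const N D.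
Proof.
  intros HN HD. unfold travel_const. pose proof (HN 1 (2 * D) ltac:(lra) ltac:(lra)). lra.
Qed.

(* The point of [beta] almost closest to [x0] is near both [c] and [a]; as these have diverged by time [R], it is near [x0]. *)
Lemma thin_corner {X : MetricSpace} (x0 z : X) N1 N2 c a R beta L k :
  geodesic_space X -> Morse_gauge N1 -> Morse_gauge N2 ->
  geodesic_segment X c x0 z -> N_Morse X N1 (fun t => 0 <= t <= mdist x0 z) c ->
  N_Morse_ray X x0 N2 a -> 0 <= R <= mdist x0 z ->
  travel_const N1 (asym_const N1 + asym_const N2) < mdist (a R) (c R) ->
  0 <= L -> 0 <= k ->
  (forall s t, 0 <= s <= L -> 0 <= t <= L -> mdist (beta s) (beta t) = Rabs (s - t)) ->
  beta 0 = z -> beta L = a k ->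
  exists t, 0 <= t <= L /\ mdist (beta t) x0 <= N1 3 1 + 1 + R.
Proof.
  intros GX H1 H2 Sc M1 [Ga [A0 M2]] HR far HL Hk Gb B0 BL.
  pose proof (mdist_nonneg x0 z) as z0. pose proof Sc as [C0 [Cz Gc]].
  destruct (near_min (fun t => 0 <= t <= L) (fun t => mdist (beta t) x0) 0)
    as [t [Ht Hmin]]; [lra|intros; apply mdist_nonneg|].
  exists t. split; [easy|].
  pose proof (qg_of_geodesic 0 L beta HL Gb) as Q.
  destruct (Morse_center N1 (fun t => 0 <= t <= mdist x0 z) c 1 0 0 L beta t x0 GX M1)
    with (u := t) (delta := 1) as [s1 [Is1 d1]]; try easy; try lra.
  { exists 0. split; [lra|easy]. }
  { exists (mdist x0 z). split; [lra|congruence]. }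
  destruct (Morse_center_r N2 nonneg a 1 0 0 L beta t x0 GX M2)
    with (u := t) (delta := 1) as [s2 [Is2 d2]]; try easy; try lra.
  { exists 0. split; [unfold nonneg; lra|easy]. }
  { exists k. easy. }
  rewrite Rmult_1_r, Rplus_0_l in *. unfold nonneg in Is2.
  (* If [s1] were at least [R], then [a s1] would be near [c s1], and [a] would fellow-travel [c] up
     to time [s1]. At time [R] this contradicts [far]. *)
  assert (s1R : s1 < R).
  { apply Rnot_le_lt. intros Rs1. revert far. apply Rle_not_lt.
    assert (E1 : mdist (c s1) (a s2) <= N1 3 1 + 1 + (N2 3 1 + 1)).
    { pose proof (mdist_tri X (c s1) (beta t) (a s2)) as T.
      rewrite (mdist_sym X (c s1) (beta t)) in T. lra. }
    assert (E2 : mdist (a s1) (a s2) <= N1 3 1 + 1 + (N2 3 1 + 1)).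
    { rewrite Ga by lra.
      replace (s1 - s2) with (mdist x0 (c s1) - mdist x0 (a s2)).
      - pose proof (mdist_close x0 x0 (c s1) (a s2)) as CL. rewrite mdist_self in CL. lra.
      - rewrite <- A0 at 2. rewrite geodesic_ray_dist0 by easy.
        rewrite <- C0. rewrite Gc by lra. rewrite Rabs_left1; lra. }
    assert (E3 : mdist (a s1) (c s1) <= asym_const N1 + asym_const N2).
    { unfold asym_const. pose proof (mdist_tri X (a s1) (a s2) (c s1)) as T.
      rewrite (mdist_sym X (a s2) (c s1)) in T. lra. }
    pose proof (asym_const_nonneg N1 H1). pose proof (asym_const_nonneg N2 H2).
    apply (fellow_travel_segment N1 c a x0 z _ s1); try easy; try lra.
    - intros; apply Ga; lra.
    - rewrite A0, mdist_self. lra.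
    - exists s1. easy. }
  pose proof (mdist_tri X (beta t) (c s1) x0) as T.
  assert (E : mdist (c s1) x0 = s1).
  { rewrite <- C0. rewrite Gc by lra. rewrite Rabs_right; lra. }
  lra.
Qed.

Definition through_gauge (N1 N2 : R -> R -> R) (D : R) : R -> R -> R :=
  join_gauge (close_gauge N1 (travel_const N1 (2 * D)))
             (close_gauge N2 (travel_const N2 (2 * D))).

Lemma through_gauge_Morse N1 N2 D :
  Morse_gauge N1 -> Morse_gauge N2 -> 0 <= D -> Morse_gauge (through_gauge N1 N2 D).
Proof.
  intros H1 H2 HD. apply join_gauge_Morse; apply close_gauge_Morse; try easy;
    apply travel_const_nonneg; (easy || lra).
Qed.

(** The ray [b] is an ultralimit of geodesics from [x0] to [a k] for integers [k]. They pass near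
    [x1], so they follow [sig] up to time [L] and a shifted copy of [a] afterwards; [b] is thus
    Morse as the union of two Morse pieces. *)
Lemma ray_through {X : MetricSpace} (x0 x1 : X) N1 N2 sig a D :
  proper_space X -> geodesic_space X -> Morse_gauge N1 -> Morse_gauge N2 -> 0 <= D ->
  geodesic_segment X sig x0 x1 -> N_Morse X N1 (fun t => 0 <= t <= mdist x0 x1) sig ->
  N_Morse_ray X x1 N2 a ->
  (forall k beta, 0 <= k -> geodesic_segment X beta x0 (a k) ->
     exists t, 0 <= t <= mdist x0 (a k) /\ mdist (beta t) x1 <= D) ->
  exists b, N_Morse_ray X x0 (through_gauge N1 N2 D) b /\ hfin X a b /\
    forall t, 0 <= t <= mdist x0 x1 -> mdist (b t) (sig t) <= travel_const N1 (2 * D).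
Proof.
  intros PX GX H1 H2 HD Ss M1 [Ga [A0 M2]] Hpass.
  pose proof Ss as [S0 [S1 Gs]].
  set (L := mdist x0 x1) in *. assert (L0 : 0 <= L) by apply mdist_nonneg.
  destruct (boolp.choice (fun k : nat => GX x0 (a (INR k)))) as [beta Hbeta].
  destruct free_ultrafilter_ex as [w W].
  set (len := fun k : nat => mdist x0 (a (INR k))).
  assert (Hlen : forall k, INR k - L <= len k).
  { intros k. unfold len. pose proof (mdist_tri X x1 x0 (a (INR k))) as T.
    rewrite (mdist_sym X x1 x0) in T. rewrite <- A0 in T at 1.
    rewrite geodesic_ray_dist0 in T by (easy || apply pos_INR). fold L in T. lra. }
  assert (Gb : forall k s t, 0 <= s <= len k -> 0 <= t <= len k ->
             mdist (beta k s) (beta k t) = Rabs (s - t)) by (intros k; apply Hbeta).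
  assert (B0 : forall k, beta k 0 = x0) by (intros k; apply Hbeta).
  assert (large : forall T, exists k0, forall k, (k0 <= k)%nat -> T <= len k).
  { intros T. destruct (INR_unbounded (T + L)) as [k0 Hk0]. exists k0. intros k Hk.
    apply le_INR in Hk. specialize (Hlen k). lra. }
  (* The passage occurs within [D] of [x1], hence at a time within [D] of [L]. This yields the
     [2 * D] in [through_gauge]. *)
  assert (mid : forall k, L <= len k -> mdist (beta k L) x1 <= 2 * D).
  { intros k Hk. destruct (Hpass (INR k) (beta k) (pos_INR k) (Hbeta k)) as [t [Ht dt]].
    fold (len k) in Ht.
    assert (E : mdist (beta k L) (beta k t) <= D).
    { rewrite Gb by lra.
      replace (L - t) with (mdist x0 x1 - mdist x0 (beta k t)).
      - pose proof (mdist_close x0 x0 x1 (beta k t)) as C.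
        rewrite mdist_self, (mdist_sym X x1 (beta k t)) in C. lra.
      - fold L. rewrite <- (B0 k). rewrite Gb by lra. rewrite (Rabs_left1 (0 - t)); lra. }
    pose proof (mdist_tri X (beta k L) (beta k t) x1). lra. }
  destruct (ulim_ray w x0 beta PX W B0) as [b [Grb [b0 Hb]]].
  { intros T HT. destruct (large T) as [k0 Hk0]. apply (uf_of_tail w _ k0 W).
    intros k Hk s t Hs Ht. specialize (Hk0 k Hk). apply Gb; lra. }
  assert (near_sig : forall t, 0 <= t <= L -> mdist (b t) (sig t) <= travel_const N1 (2 * D)).
  { intros t Ht. apply (ulim_dist_le w _ _ _ _ _ W (Hb t (proj1 Ht)) (ulim_const w (sig t) W)).
    destruct (large L) as [k0 Hk0]. apply (uf_of_tail w _ k0 W). intros k Hk.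
    specialize (Hk0 k Hk).
    apply (fellow_travel_segment N1 sig (beta k) x0 x1 (2 * D) L); try easy; try lra.
    - intros; apply Gb; lra.
    - rewrite B0, mdist_self. lra.
    - exists L. split; [fold L; lra|]. fold L in S1. rewrite S1. apply mid. easy. }
  assert (near_a : forall v, 0 <= v -> mdist (b (L + v)) (a v) <= travel_const N2 (2 * D)).
  { intros v Hv.
    apply (ulim_dist_le w _ _ _ _ _ W (Hb (L + v) ltac:(lra)) (ulim_const w (a v) W)).
    destruct (large (L + v)) as [k0 Hk0]. apply (uf_of_tail w _ k0 W). intros k Hk.
    specialize (Hk0 k Hk).
    apply (fellow_travel_ray N2 a (fun v => beta k (L + v)) (2 * D) (len k - L));
      try easy; try lra.
    - intros s t Hs Ht. rewrite Gb by lra. f_equal. ring.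
    - rewrite Rplus_0_r, A0. apply mid. lra.
    - exists (INR k). split; [apply pos_INR|].
      replace (L + (len k - L)) with (len k) by ring.
      destruct (Hbeta k) as [_ [E _]]. fold (len k) in E. rewrite E, mdist_self. lra. }
  pose proof (travel_const_nonneg N1 (2 * D) H1 ltac:(lra)) as D1.
  pose proof (travel_const_nonneg N2 (2 * D) H2 ltac:(lra)) as D2.
  exists b. split; [split; [easy|split; [easy|]]|split; [|easy]].
  - replace nonneg with (fun t => 0 <= t <= L \/ L <= t).
    2:{ apply set_ext. intros t. unfold nonneg. lra. }
    apply (Morse_join _ _ _ _ b L); try lra; try easy.
    + apply close_gauge_Morse; easy.
    + apply close_gauge_Morse; easy.
    + apply (Morse_close N1 (fun t => 0 <= t <= L) _ sig b); try easy;
        intros t Ht; exists t; (split; [easy|]); rewrite mdist_sym; apply near_sig; easy.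
    + apply (Morse_close N2 nonneg _ a b); try easy.
      * intros s Hs. exists (L + s). unfold nonneg in Hs. split; [lra|].
        rewrite mdist_sym. apply near_a. easy.
      * intros s Hs. exists (s - L). unfold nonneg. split; [lra|].
        rewrite mdist_sym. replace s with (L + (s - L)) at 1 by ring. apply near_a. lra.
  (* The initial piece of [b] is compared with the single point [a 0], hence the summand [L]. *)
  - exists (travel_const N2 (2 * D) + L). split.
    + intros s Hs. exists (L + s). split; [lra|]. rewrite mdist_sym.
      specialize (near_a s Hs). lra.
    + intros t Ht. destruct (Rle_dec L t).
      * exists (t - L). split; [lra|]. rewrite mdist_sym.
        specialize (near_a (t - L) ltac:(lra)).
        replace (L + (t - L)) with t in near_a by ring. lra.
      * exists 0. split; [lra|]. specialize (near_a 0 ltac:(lra)).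
        rewrite Rplus_0_r in near_a. rewrite (mdist_sym X (b L)) in near_a.
        pose proof (mdist_tri X (a 0) (b L) (b t)) as T.
        rewrite (Grb L t L0 Ht), Rabs_right in T by lra. lra.
Qed.

(** * Segments tending to a ray, and their separation from a compact set *)

Definition tracks {X : MetricSpace} (c : nat -> R -> X) (len : nat -> R) (gam : R -> X) :=
  forall T, 0 <= T -> exists n0, forall n, (n0 <= n)%nat ->
    T <= len n /\ forall t, 0 <= t <= T -> mdist (c n t) (gam t) < 1.

Lemma strictly_incr_ge phi n : strictly_incr phi -> (n <= phi n)%nat.
Proof.
  intros H. induction n as [|n IH]; [lia|].
  specialize (H n (S n) ltac:(lia)). lia.
Qed.

Lemma strictly_incr_comp phi psi :
  strictly_incr phi -> strictly_incr psi -> strictly_incr (fun n => phi (psi n)).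
Proof. intros H H' n m nm. apply H, H', nm. Qed.

Lemma tracks_subseq {X : MetricSpace} (c : nat -> R -> X) len gam psi :
  strictly_incr psi -> tracks c len gam ->
  tracks (fun n => c (psi n)) (fun n => len (psi n)) gam.
Proof.
  intros Hpsi H T HT. destruct (H T HT) as [n0 Hn0]. exists n0. intros n Hn.
  apply Hn0. pose proof (strictly_incr_ge psi n Hpsi). lia.
Qed.

(** Convergence at time [T + 1] with error below 1 forces the segments to be longer than [T]: a
    truncated segment would end too close to [x0]. On [[0, T]] the truncation therefore has no
    effect. *)
Lemma tracks_of_limit {X : MetricSpace} (x0 : X) (c : nat -> R -> X) y gam :
  (forall n, geodesic_segment X (c n) x0 (y n)) -> geodesic_ray X gam -> gam 0 = x0 ->
  (forall T eps, 0 <= T -> 0 < eps ->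
     exists n0, forall n, (n0 <= n)%nat -> forall t, 0 <= t <= T ->
       mdist (c n (Rmin t (mdist x0 (y n)))) (gam t) < eps) ->
  tracks c (fun n => mdist x0 (y n)) gam.
Proof.
  intros Sc Gg g0 H T HT. destruct (H (T + 1) 1 ltac:(lra) ltac:(lra)) as [n0 Hn0].
  exists n0. intros n Hn. specialize (Hn0 n Hn).
  set (l := mdist x0 (y n)) in *.
  assert (l0 : 0 <= l) by apply mdist_nonneg.
  assert (Tl : T <= l).
  { specialize (Hn0 (T + 1) ltac:(lra)).
    pose proof (mdist_tri X x0 (c n (Rmin (T + 1) l)) (gam (T + 1))) as TR.
    rewrite <- g0 in TR at 1. rewrite geodesic_ray_dist0 in TR by (easy || lra).
    destruct (Sc n) as [c0 [_ Gc]]. fold l in Gc.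
    pose proof (Rmin_r (T + 1) l).
    assert (0 <= Rmin (T + 1) l) by (apply Rmin_glb; lra).
    rewrite <- c0 in TR. rewrite Gc in TR by lra. rewrite Rabs_left1 in TR by lra. lra. }
  split; [easy|]. intros t Ht. specialize (Hn0 t ltac:(lra)).
  rewrite Rmin_left in Hn0 by lra. easy.
Qed.

(** Otherwise, for each [j], some ray of [K] is within [E] of a segment [c n] with [j <= n] at time
    [j], and so fellow-travels it up to that time. As the segments track [gam], the classes of these
    rays can accumulate only at [p], which [compact_escape] forbids. *)
Lemma uniform_separation {X : MetricSpace} (x0 : X) K p N N2 z c gam E :
  geodesic_space X ->
  (forall Q, K Q -> boundary_pt X x0 Q) -> compact_in (boundary_open X x0) K -> ~ K p ->
  boundary_pt X x0 p -> p gam ->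
  Morse_gauge N -> (forall P a, K P -> P a -> N_Morse_ray X x0 N a) -> Morse_gauge N2 ->
  (forall n : nat, geodesic_segment X (c n) x0 (z n) /\
     N_Morse X N2 (fun t => 0 <= t <= mdist x0 (z n)) (c n)) ->
  tracks c (fun n => mdist x0 (z n)) gam -> 0 <= E ->
  exists R n0, 0 <= R /\ forall n, (n0 <= n)%nat -> R <= mdist x0 (z n) /\
    forall P a, K P -> P a -> E < mdist (a R) (c n R).
Proof.
  intros GX KB CK Kp Bp pg HN KN HN2 Hc Htr HE. apply NNPP. intros no.
  assert (bad : forall j : nat, exists nPa : nat * ((R -> X) -> Prop) * (R -> X),
    let n := fst (fst nPa) in let P := snd (fst nPa) in let a := snd nPa in
    (j <= n)%nat /\ INR j <= mdist x0 (z n) /\ K P /\ P a /\ mdist (a (INR j)) (c n (INR j)) <= E).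
  { intros j. apply NNPP. intros H. apply no.
    destruct (Htr (INR j) (pos_INR j)) as [n0 Hn0].
    exists (INR j), (max n0 j). split; [apply pos_INR|]. intros n Hn.
    split; [apply Hn0; lia|]. intros P a KP Pa. apply Rnot_le_lt. intros le.
    apply H. exists (n, P, a). simpl. split; [lia|]. split; [apply Hn0; lia|]. easy. }
  destruct (boolp.choice bad) as [nPa HnPa].
  apply (compact_escape x0 K p (fun j => snd (fst (nPa j))) GX KB CK Kp).
  { intros j. apply HnPa. }
  intros N' f HN' Hf fp.
  (* The threshold bounds the chain from [f t] through [h t], [a t] and [c n t] to [gam t]. Its
     first and last links have length below 1. *)
  assert (exists t, 0 <= t /\
    asym_const N + travel_const N2 E + 2 < mdist (f t) (gam t)) as [t [Ht far]].
  { apply NNPP. intros no'. apply fp.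
    destruct (boundary_pt_eq x0 p gam Bp pg) as [_ ->]. apply mclass_eq.
    apply (hfin_pointwise _ _ (asym_const N + travel_const N2 E + 2)). intros t Ht.
    apply Rnot_lt_le. intros lt. apply no'. exists t. easy. }
  destruct (Htr t Ht) as [n0 Hn0].
  destruct (INR_unbounded t) as [j0 Hj0].
  exists (max n0 j0). apply (co_nbhd_mono f (fun h => mdist (h t) (f t) < 1)).
  2:{ apply co_nbhd_at; lra. }
  intros h ht Hh j Hj Ej. pose proof (HnPa j) as H. cbv zeta in H.
  destruct (nPa j) as [[n P] a]. simpl in *. destruct H as [jn [jl [KP [Pa close]]]].
  pose proof (KN P a KP Pa) as Ha.
  assert (tj : t <= INR j).
  { assert (j0j : (j0 <= j)%nat) by lia. apply le_INR in j0j. lra. }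
  assert (ah : hfin X a h).
  { rewrite <- Ej in Pa. apply hfin_sym, Pa. }
  pose proof (asymptotic_close x0 N a h GX HN Ha (proj1 Hh) (proj1 (proj2 Hh)) ah t Ht).
  assert (mdist (a t) (c n t) <= travel_const N2 E).
  { destruct Ha as [Ga [A0 _]]. destruct (Hc n) as [Sc Mc].
    apply (fellow_travel_segment N2 (c n) a x0 (z n) E (INR j)); try easy; try lra.
    - intros; apply Ga; lra.
    - rewrite A0, mdist_self. lra.
    - exists (INR j). split; [|easy]. lra. }
  destruct (Hn0 n ltac:(lia)) as [_ Hgam]. specialize (Hgam t ltac:(lra)).
  pose proof (mdist_tri X (f t) (h t) (gam t)).
  pose proof (mdist_tri X (h t) (a t) (gam t)).
  pose proof (mdist_tri X (a t) (c n t) (gam t)).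
  rewrite (mdist_sym X (f t) (h t)) in *. lra.
Qed.

(** * The action of the isometries on the boundary *)

Lemma act_mclass {X : MetricSpace} (x0 : X) g P a b :
  isometry X g -> boundary_pt X x0 P -> P a -> hfin X (fun t => g (a t)) b ->
  act X x0 g P = mclass X x0 b.
Proof.
  intros Hg BP Pa H. apply set_ext. intros f. split.
  - intros [Mf [a' [Pa' H']]]. split; [easy|].
    apply hfin_trans with (fun t => g (a t)); [apply hfin_sym; easy|].
    apply hfin_trans with (fun t => g (a' t)); [|easy]. apply hfin_isometry; [easy|].
    destruct (boundary_pt_eq x0 P a BP Pa) as [_ E]. rewrite E in Pa'. apply Pa'.
  - intros [Mf H']. split; [easy|]. exists a. split; [easy|].
    apply hfin_trans with b; easy.
Qed.

(** A geodesic from [x0] to [g (a k)] is pulled back by [ginv] to one from [ginv x0] to [a k], which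
    passes near [x0] by [thin_corner]. The original then passes near [g x0], as [ray_through]
    requires. The constants involve [g] only through the gauges and [R]. *)
Lemma translated_ray {X : MetricSpace} (x0 : X) g ginv P a N N1 N2 c1 c2 R :
  proper_space X -> geodesic_space X ->
  isometry X g -> (forall x, g (ginv x) = x) -> (forall x, ginv (g x) = x) ->
  Morse_gauge N -> Morse_gauge N1 -> Morse_gauge N2 ->
  geodesic_segment X c1 x0 (g x0) -> N_Morse X N1 (fun t => 0 <= t <= mdist x0 (g x0)) c1 ->
  geodesic_segment X c2 x0 (ginv x0) ->
  N_Morse X N2 (fun t => 0 <= t <= mdist x0 (ginv x0)) c2 ->
  boundary_pt X x0 P -> P a -> N_Morse_ray X x0 N a -> 0 <= R <= mdist x0 (ginv x0) ->
  travel_const N2 (asym_const N2 + asym_const N) < mdist (a R) (c2 R) ->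
  exists b, N_Morse_ray X x0 (through_gauge N1 N (N2 3 1 + 1 + R)) b /\
    act X x0 g P = mclass X x0 b /\
    forall t, 0 <= t <= mdist x0 (g x0) ->
      mdist (b t) (c1 t) <= travel_const N1 (2 * (N2 3 1 + 1 + R)).
Proof.
  intros PX GX Hg gK ginvK HN HN1 HN2 S1 M1 S2 M2 BP Pa [Ga [A0 Ma]] HR far.
  pose proof (isometry_inverse g ginv Hg gK) as Hi.
  pose proof (HN2 3 1 ltac:(lra) ltac:(lra)) as N20.
  destruct (ray_through x0 (g x0) N1 N c1 (fun t => g (a t)) (N2 3 1 + 1 + R))
    as [b [Hb [ab near]]]; try easy; try lra.
  - split; [|split].
    + intros s t Hs Ht. rewrite Hg. apply Ga; easy.
    + rewrite A0. easy.
    + apply (N_Morse_isometry g ginv); easy.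
  - intros k beta Hk [B0 [B1 Gb]].
    destruct (thin_corner x0 (ginv x0) N2 N c2 a R (fun t => ginv (beta t))
      (mdist x0 (g (a k))) k) as [t [Ht dt]]; try easy.
    + apply mdist_nonneg.
    + intros s t Hs Ht. rewrite Hi. apply Gb; easy.
    + rewrite B0. easy.
    + rewrite B1. apply ginvK.
    + exists t. split; [easy|]. rewrite <- Hi, ginvK. easy.
  - exists b. split; [easy|]. split; [|easy]. apply (act_mclass x0 g P a); easy.
Qed.

(** The contradiction for a sequence of bad points, stated for a subsequence already chosen so that
    both families of segments track a ray. *)
Lemma no_escape {X : MetricSpace} (x0 : X) g ginv p1 p2 U K P N1 N2 c1 c2 gam1 gam2 :
  proper_space X -> geodesic_space X ->
  (forall n, isometry X (g n)) ->
  (forall n x, g n (ginv n x) = x) -> (forall n x, ginv n (g n x) = x) ->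
  boundary_pt X x0 p1 -> boundary_pt X x0 p2 ->
  Morse_gauge N1 ->
  (forall n : nat, geodesic_segment X (c1 n) x0 (g n x0) /\
     N_Morse X N1 (fun t => 0 <= t <= mdist x0 (g n x0)) (c1 n)) ->
  p1 gam1 -> gam1 0 = x0 -> tracks c1 (fun n => mdist x0 (g n x0)) gam1 ->
  Morse_gauge N2 ->
  (forall n : nat, geodesic_segment X (c2 n) x0 (ginv n x0) /\
     N_Morse X N2 (fun t => 0 <= t <= mdist x0 (ginv n x0)) (c2 n)) ->
  p2 gam2 -> tracks c2 (fun n => mdist x0 (ginv n x0)) gam2 ->
  boundary_open X x0 U -> U p1 ->
  (forall Q, K Q -> boundary_pt X x0 Q) -> compact_in (boundary_open X x0) K -> ~ K p2 ->
  (forall n, K (P n)) -> (forall n, ~ U (act X x0 (g n) (P n))) -> False.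
Proof.
  intros PX GX Hg gK ginvK Bp1 Bp2 HN1 Hc1 pg1 g10 tr1 HN2 Hc2 pg2 tr2 UO Up1 KB CK Kp2
    KP bad.
  destruct (compact_stratum x0 K p2 GX KB CK Kp2) as [N [HN KN]].
  pose proof (asym_const_nonneg N HN). pose proof (asym_const_nonneg N2 HN2).
  destruct (uniform_separation x0 K p2 N N2 (fun n => ginv n x0) c2 gam2
    (travel_const N2 (asym_const N2 + asym_const N))) as [R [n0 [R0 HR]]]; try easy.
  { apply travel_const_nonneg; [easy|lra]. }
  pose proof (HN2 3 1 ltac:(lra) ltac:(lra)) as N20.
  set (D := N2 3 1 + 1 + R). set (D' := travel_const N1 (2 * D)).
  assert (D0 : 0 <= D) by (unfold D; lra).
  assert (D'0 : 0 <= D') by (apply travel_const_nonneg; [easy|lra]).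
  (* Shifting by [n0] leaves only indices at which [R] separates. The gauge and the constant [D']
     are then the same for all [n]. *)
  assert (Hray : forall n, exists b, N_Morse_ray X x0 (through_gauge N1 N D) b /\
    ~ U (mclass X x0 b) /\
    forall t, 0 <= t <= mdist x0 (g (n0 + n)%nat x0) -> mdist (b t) (c1 (n0 + n)%nat t) <= D').
  { intros n. set (m := (n0 + n)%nat).
    destruct (boundary_pt_ex x0 (P m) (KB _ (KP m))) as [a Pa].
    destruct (HR m ltac:(unfold m; lia)) as [Rm far].
    destruct (translated_ray x0 (g m) (ginv m) (P m) a N N1 N2 (c1 m) (c2 m) R)
      as [b [Hb [E near]]]; try easy; try apply Hc1; try apply Hc2.
    - apply KB, KP.
    - apply (KN (P m)); [apply KP|easy].
    - apply (far (P m)); [apply KP|easy].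
    - exists b. split; [easy|]. split; [|easy]. rewrite <- E. apply bad. }
  destruct (boolp.choice Hray) as [b Hb].
  destruct free_ultrafilter_ex as [w W].
  destruct (ulim_ray w x0 b PX W) as [f [Gf [f0 Hf]]].
  { intros n. apply (Hb n). }
  { intros T HT. apply (uf_of_tail w _ 0 W). intros n _ s t Hs Ht.
    destruct (Hb n) as [[Gb _] _]. apply Gb; lra. }
  (* The rays [b n] follow [c1], which tracks [gam1]. The limit [f] therefore stays at bounded
     distance from [gam1] and represents [p1]. *)
  assert (near : forall t, 0 <= t -> mdist (f t) (gam1 t) <= D' + 1).
  { intros t Ht. apply (ulim_dist_le w _ _ _ _ _ W (Hf t Ht) (ulim_const w (gam1 t) W)).
    destruct (tr1 t Ht) as [n1 Hn1]. apply (uf_of_tail w _ n1 W). intros n Hn.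
    destruct (Hn1 (n0 + n)%nat ltac:(lia)) as [tl Hgam]. specialize (Hgam t ltac:(lra)).
    destruct (Hb n) as [_ [_ Hbc]]. specialize (Hbc t ltac:(lra)).
    pose proof (mdist_tri X (b n t) (c1 (n0 + n)%nat t) (gam1 t)). lra. }
  destruct (boundary_pt_eq x0 p1 gam1 Bp1 pg1) as [[Ng [HNg [Gg [_ Mg]]]] E1].
  pose proof (Morse_ray_close x0 Ng gam1 f (D' + 1) HNg ltac:(lra) Mg Gf f0 near)
    as [_ [_ Mf]].
  assert (HT : Morse_gauge (through_gauge N1 N D)) by (apply through_gauge_Morse; easy).
  assert (HC : Morse_gauge (close_gauge Ng (D' + 1))) by (apply close_gauge_Morse; [easy|lra]).
  (* The sum dominates both gauges and so places the rays [b n] and their limit [f] in one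
     stratum. *)
  set (N' := fun lam eps => through_gauge N1 N D lam eps + close_gauge Ng (D' + 1) lam eps).
  destruct (uf_ex w W (fun n => U (mclass X x0 (b n)))) as [n Un].
  2:{ exact (proj1 (proj2 (Hb n)) Un). }
  apply (ulim_boundary_open x0 w b f N'); try easy.
  - intros lam eps Hl He. specialize (HT lam eps Hl He). specialize (HC lam eps Hl He).
    unfold N'. lra.
  - intros n. destruct (Hb n) as [[Gb [b0 Mb]] _]. split; [easy|]. split; [easy|].
    revert Mb. apply N_Morse_weaken. intros lam eps Hl He. specialize (HC lam eps Hl He).
    unfold N'. lra.
  - split; [easy|]. split; [easy|]. revert Mf. apply N_Morse_weaken.
    intros lam eps Hl He. specialize (HT lam eps Hl He). unfold N'. lra.
  - rewrite (mclass_eq x0 f gam1), <- E1; [easy|].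
    apply (hfin_pointwise f gam1 (D' + 1)). easy.
Qed.

Lemma subseq_of_frequently (B : nat -> Prop) :
  (forall k, exists n, (k < n)%nat /\ B n) ->
  exists phi, strictly_incr phi /\ forall n, B (phi n).
Proof.
  intros H. destruct (boolp.choice H) as [nx Hnx].
  set (phi := fix phi n := match n with O => nx O | S m => nx (phi m) end).
  exists phi. split.
  - assert (step : forall n, (phi n < phi (S n))%nat) by (intros n; apply Hnx).
    intros n m nm. induction nm as [|m nm IH]; [apply step|].
    specialize (step m). lia.
  - intros [|n]; apply Hnx.
Qed.

Theorem theorem6p6 (X : MetricSpace) (x0 : X) (g ginv : nat -> X -> X)
  (p1 p2 : (R -> X) -> Prop) (U K : ((R -> X) -> Prop) -> Prop) :
  proper_space X -> geodesic_space X ->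
  (forall n, isometry X (g n)) ->
  (forall n x, g n (ginv n x) = x) -> (forall n x, ginv n (g n x) = x) ->
  boundary_pt X x0 p1 -> boundary_pt X x0 p2 ->
  converges_to_boundary X x0 (fun n => g n x0) p1 ->
  converges_to_boundary X x0 (fun n => ginv n x0) p2 ->
  boundary_open X x0 U -> U p1 ->
  (forall P, K P -> boundary_pt X x0 P) -> compact_in (boundary_open X x0) K ->
  ~ K p2 ->
  exists phi, strictly_incr phi /\
    exists k : nat, forall n, (k < n)%nat ->
      forall P, K P -> U (act X x0 (g (phi n)) P).
Proof.
  intros PX GX Hg gK ginvK Bp1 Bp2 [N1 [HN1 [c1 [Hc1 L1]]]] [N2 [HN2 [c2 [Hc2 L2]]]]
    UO Up1 KB CK Kp2.
  (* The whole sequence works: if the inclusion failed infinitely often, the bad indices would form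
     a subsequence, to which both convergence hypotheses apply. *)
  exists (fun n => n). split; [intros n m nm; exact nm|].
  apply NNPP. intros no.
  destruct (subseq_of_frequently (fun n => exists P, K P /\ ~ U (act X x0 (g n) P)))
    as [phi [Hphi bad]].
  { intros k. apply NNPP. intros H. apply no. exists k. intros n kn P KP.
    apply NNPP. intros HP. apply H. exists n. split; [easy|]. exists P. easy. }
  destruct (L1 phi Hphi) as [psi1 [Hpsi1 [gam1 [Gg1 [g10 [pg1 lim1]]]]]].
  set (th1 := fun n => phi (psi1 n)).
  pose proof (strictly_incr_comp phi psi1 Hphi Hpsi1 : strictly_incr th1) as Hth1.
  (* The second extraction is made inside the first, so along [th] the segments to [g n x0] and to
     [ginv n x0] both converge. *)
  destruct (L2 th1 Hth1) as [psi2 [Hpsi2 [gam2 [Gg2 [g20 [pg2 lim2]]]]]].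
  set (th := fun n => th1 (psi2 n)).
  destruct (boolp.choice (fun n => bad (psi1 (psi2 n)))) as [P HP].
  apply (no_escape x0 (fun n => g (th n)) (fun n => ginv (th n)) p1 p2 U K P N1 N2
    (fun n => c1 (th n)) (fun n => c2 (th n)) gam1 gam2); try easy;
    try (intros; apply Hc1 || apply Hc2 || apply Hg || apply gK || apply ginvK || apply HP).
  - apply (tracks_subseq (fun n => c1 (th1 n)) (fun n => mdist x0 (g (th1 n) x0))); [easy|].
    apply (tracks_of_limit x0 (fun n => c1 (th1 n)) (fun n => g (th1 n) x0)); try easy.
    intros n. apply Hc1.
  - apply (tracks_of_limit x0 (fun n => c2 (th n)) (fun n => ginv (th n) x0)); try easy.
    intros n. apply Hc2.
Qed.
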